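(* Let $(X,g)$ be a compact Hermitian manifold of complex dimension $n$, let $\varpi$ be a holomorphic $k$-form on $X$ with $k\ge 3$ odd, and let $E=\bigoplus_{p=0}^n\Lambda^{(p,0)}(X)$ be the Higgs bundle with Higgs form $\theta(Z)(\phi)=\{i(Z)\varpi\}\wedge\phi$. Let $h$ be a Hermitian metric on $E$. Assume that $h(i\Lambda F_h t,t)\le 0$ pointwise for all sections $t$ of $E$. (a) If $s$ is a holomorphic section of $\bigoplus_{a\ge n-k+2}\Lambda^{(a,0)}(X)$, then $\nabla^h s\equiv 0$, $(\varepsilon(i(Z)\varpi))^{*_h}s\equiv 0$ for all holomorphic tangent vectors $Z$, and $i\Lambda F_h(s)\equiv 0$. (b) If moreover $k\ge\frac n2+1$, then $\varpi=0$.
   Context: A Higgs bundle over a complex manifold $X$ is a holomorphic vector bundle $E\to X$ together with a holomorphic section $\theta$ of $\mathrm{Hom}(E)\otimes\Lambda^{(1,0)}(X)$ satisfying $\theta\wedge\theta=0$, i.e. $[\theta(Z),\theta(W)]=0$ for all holomorphic tangent vectors $Z,W$ at a point. $\Lambda^{(p,0)}(X)$ is the holomorphic bundle of $(p,0)$-forms, $i(Z)$ is interior multiplication, and $\varepsilon(\alpha)$ is exterior multiplication by the form $\alpha$, viewed here as an endomorphism of $E$. The symbol $*_h$ denotes the pointwise adjoint with respect to $h$. For a Hermitian metric $h$ on $E$, let $\nabla^h=\partial_h+\bar\partial$ be the Hermitian (Chern) connection, and let $\overline{\theta_h}$ be defined by $h(\overline{\theta_h}(Y)s,t)=h(s,\theta(\overline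 Y)t)$. Put $D''=\bar\partial+\theta$, $D'_h=\partial_h+\overline{\theta_h}$, $D_h=D'_h+D''$, and $F_h=(D_h)^2$. Put $i\Lambda F_h=\sum_{i=1}^n F_h(Z_i,\overline{Z_i})$, where $\{Z_i\}$ is a $g$-orthonormal basis of $T^{(1,0)}X$ at a point. No relation between $g$ and $h$ is assumed. *)

(* Defs.v *)
(* MathComp, with MathComp-Analysis. *)
From HB Require Import structures.
From mathcomp Require Import all_boot all_order all_algebra.
From mathcomp Require Import complex.
From mathcomp Require Import all_classical all_reals all_analysis.

Set Implicit Arguments.
Unset Strict Implicit.
Unset Printing Implicit Defensive.

Import Order.TTheory GRing.Theory Num.Theory numFieldNormedType.Exports.

Local Open Scope classical_set_scope.
Local Open Scope complex_scope.
Local Open Scope ring_scope.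

(* The usual topology of C, which the library only puts on the alias R[i]^o. *)
HB.instance Definition _ (R : realType) := NormedModule.copy R[i] R[i]^o.
HB.instance Definition _ (R : realType) := Vector.copy R[i] R[i]^o.

Section Calculus.
Variables (R : realType) (n : nat).
Local Notation C := R[i].
Local Notation Cn := 'rV[R[i]]_n.
Implicit Types (U : set Cn) (f : Cn -> C) (z v : Cn).

(* Derivatives of f : C^n -> C are those of the underlying map
   R^2n -> R^2, taken along a real line z + t v, t in R. *)
Definition rderivable v f z : Prop :=
  derivable (fun t : R => complex.Re (f (z + t%:C *: v))) 0 1 /\
  derivable (fun t : R => complex.Im (f (z + t%:C *: v))) 0 1.

Definition rderive v f z : C :=
  derive1 (fun t : R => complex.Re (f (z + t%:C *: v))) 0 +i*
  derive1 (fun t : R => complex.Im (f (z + t%:C *: v))) 0.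

Fixpoint Ck (k : nat) U f : Prop :=
  (forall z, U z -> {for z, continuous f}) /\
  (if k is k'.+1 then
     forall v, (forall z, U z -> rderivable v f z) /\ Ck k' U (rderive v f)
   else True).

(* Only used for open U. *)
Definition smooth U f : Prop := forall k, Ck k U f.

(* d/dz_j = (d/dx_j - i d/dy_j)/2 and d/dzbar_j = (d/dx_j + i d/dy_j)/2. *)
Definition ddz (j : 'I_n) f z : C :=
  2%:R^-1 * (rderive (delta_mx 0 j) f z
             - 'i * rderive ('i *: delta_mx 0 j) f z).

Definition ddzb (j : 'I_n) f z : C :=
  2%:R^-1 * (rderive (delta_mx 0 j) f z
             + 'i * rderive ('i *: delta_mx 0 j) f z).

(* Smooth with dbar f = 0, which for open U is equivalent to f being
   holomorphic. *)
Definition holomorphic U f : Prop :=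
  smooth U f /\ forall z j, U z -> ddzb j f z = 0.

End Calculus.

(* [chart_inv i] inverts the chart [chart_map i : chart_dom i -> C^n]; outside
   chart_dom i and its image the two maps are unconstrained. *)
Record complexAtlas (R : realType) (n : nat) (X : topologicalType) := {
  chart : Type;
  chart_dom : chart -> set X;
  chart_map : chart -> X -> 'rV[R[i]]_n;
  chart_inv : chart -> 'rV[R[i]]_n -> X;
  chart_dom_open : forall i, open (chart_dom i);
  chart_dom_cover : forall x, exists i, chart_dom i x;
  chart_img_open : forall i, open (chart_map i @` chart_dom i);
  chart_mapK : forall i x, chart_dom i x -> chart_inv i (chart_map i x) = x;
  chart_map_continuous : forall i x, chart_dom i x ->
    {for x, continuous (chart_map i)};
  chart_inv_continuous : forall i z, (chart_map i @` chart_dom i) z ->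
    {for z, continuous (chart_inv i)};
  transition_holomorphic : forall i j (a : 'I_n),
    holomorphic (chart_map i @` (chart_dom i `&` chart_dom j))
      (fun z => chart_map j (chart_inv i z) 0 a)
}.

Definition chart_img (R : realType) (n : nat) (X : topologicalType)
    (A : complexAtlas R n X) (i : chart A) : set 'rV[R[i]]_n :=
  chart_map i @` chart_dom i.

Section ExteriorAlgebra.
Variables (R : realType) (n : nat).
Local Notation C := R[i].

(* The fibre of (+)_p Lambda^(p,0) in a chart: the form
   sum_S w(S) dz^S, where dz^S = dz_(s1) /\ ... /\ dz_(sp) for
   S = {s1 < ... < sp}. *)
Definition ext := {ffun {set 'I_n} -> C}.
HB.instance Definition _ := GRing.Lmodule.on ext.
HB.instance Definition _ := Vector.on ext.

Implicit Types (w y : ext) (Z : 'rV[C]_n).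

Definition inversions (A B : {set 'I_n}) : nat :=
  #|[pred p : 'I_n * 'I_n | [&& p.1 \in A, p.2 \in B & (p.2 < p.1)%N]]|.

Definition ext_wedge w y : ext :=
  [ffun S : {set 'I_n} => \sum_(A : {set 'I_n} | A \subset S)
     (-1) ^+ inversions A (S :\: A) * w A * y (S :\: A)].

(* Interior multiplication by Z = sum_a Z_a d/dz_a. *)
Definition ext_contract Z w : ext :=
  [ffun T : {set 'I_n} => \sum_(a : 'I_n | a \notin T)
     (-1) ^+ #|[pred b in T | (b < a)%N]| * Z 0 a * w (a |: T)].

Definition ext1 : ext := [ffun S : {set 'I_n} => (S == finset.set0)%:R].

Definition dz (a : 'I_n) : ext :=
  [ffun S : {set 'I_n} => (S == finset.set1 a)%:R].

(* Pull-back of forms by a linear map u |-> u *m J: it sends dz_a to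
   sum_b J_(b,a) dz_b and is multiplicative. *)
Definition pullback (J : 'M[C]_n) w : ext :=
  \sum_(S : {set 'I_n}) w S *:
    \big[ext_wedge/ext1]_(a <- enum S) (\sum_(b : 'I_n) J b a *: dz b).

End ExteriorAlgebra.

Section Fields.
Variables (R : realType) (n : nat) (X : topologicalType).
Variable (A : complexAtlas R n X).
Local Notation C := R[i].
Local Notation Cn := 'rV[R[i]]_n.
Local Notation E := (ext R n).

(* Transposed Jacobian of chart_map j \o chart_inv i: a tangent vector with
   components u in the chart i has components u *m jac i j z in the chart j. *)
Definition jac (i j : chart A) (z : Cn) : 'M[C]_n :=
  \matrix_(b, a) ddz b (fun w => chart_map j (chart_inv i w) 0 a) z.

(* Tensor fields are given by their components in all the charts; only the
   values on the image of the chart are meaningful. *)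
Definition is_section (s : chart A -> Cn -> E) : Prop :=
  forall i j x, chart_dom i x -> chart_dom j x ->
    s i (chart_map i x)
    = pullback (jac i j (chart_map i x)) (s j (chart_map j x)).

Definition smooth_section (s : chart A -> Cn -> E) : Prop :=
  is_section s /\ forall i S, smooth (chart_img i) (fun z => s i z S).

Definition holomorphic_section (s : chart A -> Cn -> E) : Prop :=
  is_section s /\ forall i S, holomorphic (chart_img i) (fun z => s i z S).

(* s is a section of the sum of the Lambda^(p,0) with p satisfying P. *)
Definition in_degrees (P : pred nat) (s : chart A -> Cn -> E) : Prop :=
  forall i z (S : {set 'I_n}), chart_img i z -> ~~ P #|S| -> s i z S = 0.

Definition holomorphic_form (k : nat) (w : chart A -> Cn -> E) : Prop :=
  holomorphic_section w /\ in_degrees (pred1 k) w.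

(* Hermitian metrics on T^(1,0)X and on E, linear in the first argument. *)
Definition hermitian_metric_T
    (g : chart A -> Cn -> {dot Cn for Num.conj}) : Prop :=
  (forall i u v, smooth (chart_img i) (fun z => g i z u v)) /\
  (forall i j x u v, chart_dom i x -> chart_dom j x ->
     g j (chart_map j x) (u *m jac i j (chart_map i x))
                     (v *m jac i j (chart_map i x))
     = g i (chart_map i x) u v).

Definition hermitian_metric_E
    (h : chart A -> Cn -> {dot E for Num.conj}) : Prop :=
  (forall i u v, smooth (chart_img i) (fun z => h i z u v)) /\
  (forall i j x u v, chart_dom i x -> chart_dom j x ->
     h i (chart_map i x) (pullback (jac i j (chart_map i x)) u)
                     (pullback (jac i j (chart_map i x)) v)
     = h j (chart_map j x) u v).

End Fields.

(* Differential operators in a chart, for the metric h in that chart. A complex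
   tangent vector is a pair v = (v.1, v.2) standing for
   sum_j v.1_j d/dz_j + v.2_j d/dzbar_j. *)
Section Operators.
Variables (R : realType) (n : nat).
Local Notation C := R[i].
Local Notation Cn := 'rV[R[i]]_n.
Local Notation E := (ext R n).
Variables (h : Cn -> {dot E for Num.conj}) (theta : Cn -> Cn -> E -> E).
Implicit Types (a b : Cn) (v w : Cn * Cn) (s t : Cn -> E) (z : Cn).

Definition conjv a : Cn := map_mx Num.conj a.

(* The adjoint of B applied to w; for linear B it exists and is unique, the
   form being positive definite in finite dimension. *)
Definition adjoint (form : {dot E for Num.conj}) (B : E -> E) (w : E) : E :=
  xget 0 [set u | forall y : E, form u y = form w (B y)].

Definition del a (f : Cn -> C) z : C := \sum_j a 0 j * ddz j f z.

(* dz^S is a holomorphic frame, so dbar acts on components. *)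
Definition dbar b s z : E :=
  [ffun S => \sum_j b 0 j * ddzb j (fun y => s y S) z].

(* The (1,0)-part of the Chern connection: the only value making the
   connection del_h + dbar compatible with h. It exists for s smooth near z,
   and is unique since the constant t are allowed. *)
Definition del_h a s z : E :=
  xget 0 [set u | forall U t, open U -> U z ->
    (forall S, smooth U (fun y => t y S)) ->
    del a (fun y => h y (s y) (t y)) z
    = h z u (t z) + h z (s z) (dbar (conjv a) t z)].

Definition nabla v s z : E := del_h v.1 s z + dbar v.2 s z.

Definition theta_bar b z : E -> E := adjoint (h z) (theta z (conjv b)).

Definition D'' v s z : E := dbar v.2 s z + theta z v.1 (s z).

Definition D'_h v s z : E := del_h v.1 s z + theta_bar v.2 z (s z).

Definition D_h v s z : E := D'_h v s z + D'' v s z.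

(* (D_h)^2 evaluated on (v, w), extended with constant coefficients, so that
   [v, w] = 0. *)
Definition F_h v w s z : E :=
  D_h v (D_h w s) z - D_h w (D_h v s) z.

(* The trace sum_a F_h(Z_a, conj Z_a) over the rows Z_a of Z, which are meant to
   be an orthonormal basis of T^(1,0) at z; it does not depend on that basis. *)
Definition iLambdaF (Z : 'M[C]_n) s z : E :=
  \sum_(a < n) F_h (row a Z, 0) (0, conjv (row a Z)) s z.

End Operators.

Definition orthonormal_basis (R : realType) (n : nat)
    (g : {dot 'rV[R[i]]_n for Num.conj}) (Z : 'M[R[i]]_n) : Prop :=
  forall a b, g (row a Z) (row b Z) = (a == b)%:R.

(* theta(Z)(phi) = (i(Z) w) /\ phi at the point z. *)
Definition higgs (R : realType) (n : nat) (w : 'rV[R[i]]_n -> ext R n)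
    (z Z : 'rV[R[i]]_n) : ext R n -> ext R n :=
  ext_wedge (ext_contract Z (w z)).

(* Main.v *)
Require Import Defs.
From HB Require Import structures.
From mathcomp Require Import all_boot all_order all_algebra.
From mathcomp Require Import complex.
From mathcomp Require Import all_classical all_reals all_analysis.
From mathcomp Require Import ring lra zify.

(* For a holomorphic section s of high degree, theta s vanishes for degree
   reasons, so D'' s = 0. With sigma_Z the (1,0)-derivative of s along Z and
   tau_Z = theta(Z)^* s, holomorphy of theta turns the curvature into
   theta(Z) tau_Z - dbar sigma_Z, and the Bochner identity
     sum_a d_{conj Z_a} d_{Z_a} |s|^2
       = sum_a |sigma_{Z_a}|^2 + sum_a |tau_{Z_a}|^2 - h(i Lambda F s, s)
   makes |s|^2 subharmonic for a second-order elliptic operator without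
   zero-order term. Hopf's strong maximum principle and compactness make |s|^2
   locally constant, so all the terms on the right vanish. For part (b), apply
   this to s = varpi: by Euler's identity varpi is, up to the factor k, a sum of
   elements of the images of the epsilon(i(Z) varpi), to which it is orthogonal. *)

Set Implicit Arguments.
Unset Strict Implicit.
Unset Printing Implicit Defensive.

Import Order.TTheory GRing.Theory Num.Theory numFieldNormedType.Exports.

Local Open Scope classical_set_scope.
Local Open Scope complex_scope.
Local Open Scope ring_scope.

(** * Derivatives along real lines and smooth functions *)

(** No Kähler condition ties the operator [sum_a d_{conj Z_a} d_{Z_a}] to an integration by parts,
    since [g] is merely Hermitian and unrelated to [h]; a maximum principle only sees the
    second-order part and a sign. The bases [Z] are chosen separately at each point, with no
    continuity, but the coefficients of the operator depend only on the inverse Gram matrix of [g],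
    which is smooth. The values [adjoint] and [del_h] are selected by [xget], so neither their
    existence nor their regularity is automatic. Both come from an explicit Riesz vector, computed
    with the inverse Gram matrix of [h]. The derivative of [theta(Z)^* s] is identified directly
    through the property that characterizes [del_h]. Derivatives are taken along single real lines,
    so even their additivity in the direction has to be derived from continuity. Since [X] is not
    assumed connected, the conclusion about the norm is local constancy. Equality in the Bochner
    identity only yields [h(i Lambda F s, s) = 0]; the vector [i Lambda F s] itself vanishes because
    sigma and tau vanish on whole chart images. *)

Section PathDerivative.
Variable R : realType.
Local Notation C := R[i].
Implicit Types (F G : R -> C) (t : R) (l m : C).

Lemma complex_eqP (x y : C) : complex.Re x = complex.Re y ->
  complex.Im x = complex.Im y -> x = y.
Proof. by case: x y => [a b] [c d] /= -> ->. Qed.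

Lemma cReM (x y : C) : complex.Re (x * y) =
  complex.Re x * complex.Re y - complex.Im x * complex.Im y.
Proof. by case: x y => [a b] [c d]. Qed.

Lemma cImM (x y : C) : complex.Im (x * y) =
  complex.Re x * complex.Im y + complex.Im x * complex.Re y.
Proof. by case: x y => [a b] [c d]. Qed.

Lemma cReD (x y : C) : complex.Re (x + y) = complex.Re x + complex.Re y.
Proof. by case: x y => [a b] [c d]. Qed.

Lemma cImD (x y : C) : complex.Im (x + y) = complex.Im x + complex.Im y.
Proof. by case: x y => [a b] [c d]. Qed.

Lemma cReN (x : C) : complex.Re (- x) = - complex.Re x.
Proof. by case: x. Qed.

Lemma cImN (x : C) : complex.Im (- x) = - complex.Im x.
Proof. by case: x. Qed.

Lemma cRe_conj (x : C) : complex.Re (Num.conj x) = complex.Re x.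
Proof. by case: x. Qed.

Lemma cIm_conj (x : C) : complex.Im (Num.conj x) = - complex.Im x.
Proof. by case: x. Qed.

(** Also valid at 0, where both sides are 0. It reduces the derivative of an inverse to those of a
    real inverse and of a conjugate. *)
Lemma invc_conj (x : C) :
  x^-1 = ((complex.Re x ^+ 2 + complex.Im x ^+ 2)^-1)%:C * Num.conj x.
Proof.
case: x => [a b].
apply: complex_eqP; rewrite ?cReM ?cImM /=; ring.
Qed.

Lemma sqr_norm_neq0 (x : C) : x != 0 ->
  complex.Re x ^+ 2 + complex.Im x ^+ 2 != 0.
Proof.
apply: contra; case: x => [a b] /=.
rewrite paddr_eq0 ?sqr_ge0 // !sqrf_eq0 => /andP[/eqP-> /eqP->].
by rewrite eq_complex /= eqxx.
Qed.

Lemma is_derive_ext (f g : R -> R) t d d' : f =1 g -> d = d' ->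
  is_derive t (1 : R) f d -> is_derive t (1 : R) g d'.
Proof. by move=> /funext -> ->. Qed.

Definition is_cderive F t l : Prop :=
  is_derive t (1 : R) (fun x => complex.Re (F x)) (complex.Re l) /\
  is_derive t (1 : R) (fun x => complex.Im (F x)) (complex.Im l).

Lemma is_cderive_near F G t l : {near t, F =1 G} ->
  is_cderive F t l -> is_cderive G t l.
Proof.
move=> FG [Fr Fi]; split.
- by apply: near_eq_is_derive Fr; apply: filterS FG => x ->.
- by apply: near_eq_is_derive Fi; apply: filterS FG => x ->.
Qed.

Lemma is_cderive_ext F G t l m : F =1 G -> l = m ->
  is_cderive F t l -> is_cderive G t m.
Proof. by move=> /funext -> ->. Qed.

Lemma is_cderive_cst (a : C) t : is_cderive (fun=> a) t 0.
Proof. by split; exact: is_derive_cst. Qed.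

Lemma is_cderiveD F G t l m : is_cderive F t l -> is_cderive G t m ->
  is_cderive (fun x => F x + G x) t (l + m).
Proof.
move=> [Fr Fi] [Gr Gi]; split.
- by apply: is_derive_ext (is_deriveD Fr Gr) => [x|]; rewrite (cReD, cImD).
- by apply: is_derive_ext (is_deriveD Fi Gi) => [x|]; rewrite (cReD, cImD).
Qed.

Lemma is_cderiveM F G t l m : is_cderive F t l -> is_cderive G t m ->
  is_cderive (fun x => F x * G x) t (l * G t + F t * m).
Proof.
move=> [Fr Fi] [Gr Gi]; split.
- apply: is_derive_ext (is_deriveB (is_deriveM Fr Gr) (is_deriveM Fi Gi)).
  + by move=> x; rewrite cReM.
  + by rewrite cReD !cReM /GRing.scale /=; ring.
- apply: is_derive_ext (is_deriveD (is_deriveM Fr Gi) (is_deriveM Fi Gr)).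
  + by move=> x; rewrite cImM.
  + by rewrite cImD !cImM /GRing.scale /=; ring.
Qed.

Lemma is_cderive_conj F t l : is_cderive F t l ->
  is_cderive (fun x => Num.conj (F x)) t (Num.conj l).
Proof.
move=> [Fr Fi]; split.
- by apply: is_derive_ext Fr => [x|]; rewrite cRe_conj.
- by apply: is_derive_ext (is_deriveN Fi) => [x|]; rewrite cIm_conj.
Qed.

Lemma is_cderive_ofreal (f : R -> R) t d : is_derive t (1 : R) f d ->
  is_cderive (fun x => (f x)%:C) t d%:C.
Proof. by move=> fd; split => //=; exact: is_derive_cst. Qed.

Lemma is_cderiveV F t l : F t != 0 -> is_cderive F t l ->
  is_cderive (fun x => (F x)^-1) t (- (F t ^- 2 * l)).
Proof.
move=> Ft0 Fl.
have [Fr Fi] := Fl.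
have N0 := sqr_norm_neq0 Ft0.
have dN := is_deriveD (is_deriveX 2 Fr) (is_deriveX 2 Fi).
have dV := is_deriveV
  (f := fun x => complex.Re (F x) ^+ 2 + complex.Im (F x) ^+ 2) N0 dN.
have := is_cderiveM (is_cderive_ofreal dV) (is_cderive_conj Fl).
apply: is_cderive_ext => [x|]; first by rewrite invc_conj.
have F20 : F t ^+ 2 != 0 by rewrite expf_neq0.
apply: (mulfI F20); rewrite mulrN mulVKf //.
rewrite /GRing.scale /=.
case: (F t) N0 l {Fl Fr Fi dN dV Ft0} => [a b] /= N0 [c d].
by apply: complex_eqP;
  rewrite !(expr2, cReN, cImN, cReD, cImD, cReM, cImM, cRe_conj, cIm_conj) /=; field.
Qed.

End PathDerivative.

Section LineDerivative.
Variables (R : realType) (n : nat).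
Local Notation C := R[i].
Local Notation Cn := 'rV[R[i]]_n.
Implicit Types (U V : set Cn) (f g : Cn -> C) (z v : Cn) (l m : C).

Lemma real_complex_continuous : continuous (fun t : R => t%:C).
Proof.
move=> t; apply/(@cvgrPdist_lt _ _ _ (nbhs t)) => e e0.
(* The norm of [R[i]] takes its values in [R[i]], so a positive [e] is first recognized as a real
   number. *)
have eE : e = (complex.Re e)%:C by rewrite RRe_real ?gtr0_real.
move: e0; rewrite eE ltcR => e0.
near=> s; rewrite -raddfB normc_def /= expr0n /= addr0 sqrtr_sqr ltcR.
by near: s; apply: cvgr_dist_lt => //; exact: cvg_id.
Unshelve. all: by end_near. Qed.

Lemma line_continuous z v : continuous (fun t : R => z + t%:C *: v).
Proof.
move=> t; apply: cvgD; first exact: cvg_cst.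
by apply: cvgZr_tmp; exact: real_complex_continuous.
Qed.

Lemma line0 z v : z + (0 : R)%:C *: v = z.
Proof. by rewrite scale0r addr0. Qed.

Lemma near_line U z v : nbhs z U -> \forall t \near (0 : R), U (z + t%:C *: v).
Proof. by move=> Uz; apply: (@line_continuous z v 0); rewrite line0. Qed.

Definition is_rderive v f z l := is_cderive (fun t : R => f (z + t%:C *: v)) 0 l.

Lemma is_rderive_rderivable v f z l : is_rderive v f z l -> rderivable v f z.
Proof. by move=> [[? _] [? _]]. Qed.

Lemma is_rderive_rderive v f z l : is_rderive v f z l -> rderive v f z = l.
Proof.
move=> [[_ fr] [_ fi]]; apply: complex_eqP => /=; rewrite derive1E.
- exact: fr.
- exact: fi.
Qed.

Lemma rderivableP v f z : rderivable v f z -> is_rderive v f z (rderive v f z).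
Proof.
by move=> [fr fi]; split; rewrite /= derive1E; apply: DeriveDef.
Qed.

Lemma is_rderive_near v f g z l : {near z, f =1 g} ->
  is_rderive v f z l -> is_rderive v g z l.
Proof. by move=> fg; apply: is_cderive_near; exact: (near_line v fg). Qed.

Lemma rderive_near v f g z : {near z, f =1 g} -> rderive v f z = rderive v g z.
Proof.
move=> fg; apply: complex_eqP => /=; rewrite !derive1E; apply: near_eq_derive;
  by apply: filterS (near_line v fg) => t /= ->.
Qed.

Lemma is_rderive_ext v f g z l m : f =1 g -> l = m ->
  is_rderive v f z l -> is_rderive v g z m.
Proof. by move=> /funext -> ->. Qed.

Lemma is_rderive_cst v (a : C) z : is_rderive v (fun=> a) z 0.
Proof. exact: is_cderive_cst. Qed.

Lemma is_rderiveD v f g z l m : is_rderive v f z l -> is_rderive v g z m ->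
  is_rderive v (fun y => f y + g y) z (l + m).
Proof. exact: is_cderiveD. Qed.

Lemma is_rderiveM v f g z l m : is_rderive v f z l -> is_rderive v g z m ->
  is_rderive v (fun y => f y * g y) z (l * g z + f z * m).
Proof. by move=> df dg; have := is_cderiveM df dg; rewrite !line0. Qed.

Lemma is_rderive_conj v f z l : is_rderive v f z l ->
  is_rderive v (fun y => Num.conj (f y)) z (Num.conj l).
Proof. exact: is_cderive_conj. Qed.

Lemma is_rderiveV v f z l : f z != 0 -> is_rderive v f z l ->
  is_rderive v (fun y => (f y)^-1) z (- (f z ^- 2 * l)).
Proof.
move=> f0 df.
have f0' : f (z + (0 : R)%:C *: v) != 0 by rewrite line0.
by have := is_cderiveV f0' df; rewrite !line0.
Qed.

Lemma is_rderiveZ v (a : C) f z l : is_rderive v f z l ->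
  is_rderive v (fun y => a * f y) z (a * l).
Proof.
move=> df; apply: is_rderive_ext (is_rderiveM (is_rderive_cst v a z) df) => //.
by rewrite mul0r add0r.
Qed.

Lemma is_rderive_sum (I : Type) (r : seq I) (P : pred I) v (f : I -> Cn -> C) z
    (l : I -> C) : (forall i, P i -> is_rderive v (f i) z (l i)) ->
  is_rderive v (fun y => \sum_(i <- r | P i) f i y) z (\sum_(i <- r | P i) l i).
Proof.
move=> df; elim: r => [|i r IH].
  by apply: is_rderive_ext (is_rderive_cst v 0 z) => [y|]; rewrite big_nil.
rewrite big_cons; under eq_fun do rewrite big_cons.
by case Pi: (P i) => //; apply: is_rderiveD => //; exact: df.
Qed.

End LineDerivative.

Lemma conj_continuous (R : realType) : continuous (@Num.conj R[i]).
Proof.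
move=> t; apply/(@cvgrPdist_lt _ _ _ (nbhs t)) => e e0.
near=> s; rewrite -rmorphB norm_conjC.
by near: s; apply: cvgr_dist_lt => //; exact: cvg_id.
Unshelve. all: by end_near. Qed.

(** * Closure properties of smooth functions *)

Section SmoothCalculus.
Variables (R : realType) (n : nat).
Local Notation C := R[i].
Local Notation Cn := 'rV[R[i]]_n.
Implicit Types (U V : set Cn) (f g : Cn -> C) (z v : Cn) (k : nat).

Lemma Ck_cont k U f : Ck k U f -> forall z, U z -> {for z, continuous f}.
Proof. by case: k => [|k] []. Qed.

Lemma CkS k U f : Ck k.+1 U f -> Ck k U f.
Proof.
elim: k f => [|k IH] f [fc fd]; split=> // v.
by have [fv /IH] := fd v.
Qed.

Lemma Ck_sub k U V f : V `<=` U -> Ck k U f -> Ck k V f.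
Proof.
move=> VU; elim: k f => [|k IH] f [fc fd].
  by split=> // z /VU /fc.
split=> [z /VU /fc //|v].
by have [fv /IH] := fd v; split=> // z /VU; exact: fv.
Qed.

Lemma Ck_rderivable k U f v z : Ck k.+1 U f -> U z ->
  is_rderive v f z (rderive v f z).
Proof. by move=> [_ /(_ v)[fv _]] /fv; exact: rderivableP. Qed.

Lemma continuous_near (T T' : topologicalType) (F G : T -> T') (x : T) :
  {near x, F =1 G} -> {for x, continuous F} -> {for x, continuous G}.
Proof.
move=> FG Fx; rewrite /prop_for /continuous_at -(nbhs_singleton FG).
exact: cvg_trans (near_eq_cvg FG) Fx.
Qed.

Lemma open_near U f g z : open U -> (forall z, U z -> f z = g z) -> U z ->
  {near z, f =1 g}.
Proof. by move=> oU fg Uz; apply: filterS (open_nbhs_nbhs (conj oU Uz)). Qed.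

Lemma Ck_ext k U f g : open U -> (forall z, U z -> f z = g z) ->
  Ck k U f -> Ck k U g.
Proof.
move=> oU; elim: k f g => [|k IH] f g fg fk.
  split=> // z Uz; apply: continuous_near (Ck_cont fk Uz).
  exact: (open_near oU fg Uz).
split=> [z Uz|v].
  by apply: continuous_near (Ck_cont fk Uz); exact: (open_near oU fg Uz).
have [fv fvk] := fk.2 v; split.
  move=> z Uz; apply: is_rderive_rderivable (is_rderive_near _ (rderivableP (fv z Uz))).
  exact: (open_near oU fg Uz).
by apply: IH fvk => z Uz; apply: rderive_near; exact: (open_near oU fg Uz).
Qed.

(** Lets the inductions below exhibit a [Ck k] formula for the derivative on [U] alone, instead of
    computing [rderive v f] everywhere. *)
Lemma Ck_step k U f : open U -> (forall z, U z -> {for z, continuous f}) ->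
  (forall v, exists2 f', Ck k U f' & forall z, U z -> is_rderive v f z (f' z)) ->
  Ck k.+1 U f.
Proof.
move=> oU fc fd; split=> // v; have [f' f'k ff'] := fd v; split.
  by move=> z Uz; apply: is_rderive_rderivable (ff' z Uz).
by apply: Ck_ext f'k => // z Uz; rewrite (is_rderive_rderive (ff' z Uz)).
Qed.

Lemma Ck_cst k U (a : C) : open U -> Ck k U (fun=> a).
Proof.
move=> oU; elim: k a => [|k IH] a; first by split => // z _; exact: cst_continuous.
apply: Ck_step => // [z _|v]; first exact: cst_continuous.
by exists (fun=> 0) => // z _; exact: is_rderive_cst.
Qed.

Lemma CkD k U f g : open U -> Ck k U f -> Ck k U g ->
  Ck k U (fun y => f y + g y).
Proof.
move=> oU; elim: k f g => [|k IH] f g fk gk.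
  split=> // z Uz; apply: continuousD; [exact: fk.1|exact: gk.1].
apply: Ck_step => // [z Uz|v].
  by apply: continuousD; [exact: fk.1|exact: gk.1].
exists (fun y => rderive v f y + rderive v g y).
  by apply: IH; [exact: (fk.2 v).2|exact: (gk.2 v).2].
by move=> z Uz; exact: is_rderiveD (Ck_rderivable v fk Uz) (Ck_rderivable v gk Uz).
Qed.

Lemma CkM k U f g : open U -> Ck k U f -> Ck k U g ->
  Ck k U (fun y => f y * g y).
Proof.
move=> oU; elim: k f g => [|k IH] f g fk gk.
  split=> // z Uz; apply: continuousM; [exact: fk.1|exact: gk.1].
apply: Ck_step => // [z Uz|v].
  by apply: continuousM; [exact: fk.1|exact: gk.1].
exists (fun y => rderive v f y * g y + f y * rderive v g y).
  by apply: CkD => //; apply: IH; try exact: CkS; [exact: (fk.2 v).2|exact: (gk.2 v).2].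
by move=> z Uz; exact: is_rderiveM (Ck_rderivable v fk Uz) (Ck_rderivable v gk Uz).
Qed.

Lemma Ck_conj k U f : open U -> Ck k U f -> Ck k U (fun y => Num.conj (f y)).
Proof.
have cc h z : {for z, continuous h} ->
    {for z, continuous (fun y : Cn => Num.conj (h y : C))}.
  by move=> hz; apply: continuous_comp; [exact: hz|exact: conj_continuous].
move=> oU; elim: k f => [|k IH] f fk.
  by split=> // z Uz; apply: cc; exact: fk.1.
apply: Ck_step => // [z Uz|v]; first by apply: cc; exact: fk.1.
exists (fun y => Num.conj (rderive v f y)); first exact: IH (fk.2 v).2.
by move=> z Uz; apply: is_rderive_conj; exact: (Ck_rderivable v fk Uz).
Qed.

Lemma CkN k U f : open U -> Ck k U f -> Ck k U (fun y => - f y).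
Proof.
move=> oU fk; apply: (Ck_ext (f := fun y => -1 * f y)) => //.
  by move=> z _; rewrite mulN1r.
by apply: CkM => //; exact: Ck_cst.
Qed.

Lemma CkV k U f : open U -> (forall z, U z -> f z != 0) -> Ck k U f ->
  Ck k U (fun y => (f y)^-1).
Proof.
move=> oU f0; elim: k => [|k IH] fk.
  by split=> // z Uz; exact: (continuousV (f0 z Uz) (fk.1 z Uz)).
apply: Ck_step => // [z Uz|v]; first exact: (continuousV (f0 z Uz) (fk.1 z Uz)).
(* [f^-2] is split into two copies of [f^-1] so that the induction hypothesis applies. *)
exists (fun y => - ((f y)^-1 * (f y)^-1 * rderive v f y)).
  have Vk := IH (CkS fk).
  by apply: CkN => //; apply: CkM => //; [exact: CkM|exact: (fk.2 v).2].
move=> z Uz; rewrite -expr2 exprVn; apply: is_rderiveV; first exact: f0.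
exact: (Ck_rderivable v fk Uz).
Qed.

Lemma Ck_sum (I : Type) (r : seq I) (P : pred I) k U (f : I -> Cn -> C) : open U ->
  (forall i, P i -> Ck k U (f i)) -> Ck k U (fun y => \sum_(i <- r | P i) f i y).
Proof.
move=> oU fk; elim: r => [|i r IH].
  by under eq_fun do rewrite big_nil; exact: Ck_cst.
under eq_fun do rewrite big_cons.
by case Pi: (P i) => //; apply: CkD => //; exact: fk.
Qed.

Lemma Ck_prod (I : Type) (r : seq I) (P : pred I) k U (f : I -> Cn -> C) : open U ->
  (forall i, P i -> Ck k U (f i)) -> Ck k U (fun y => \prod_(i <- r | P i) f i y).
Proof.
move=> oU fk; elim: r => [|i r IH].
  by under eq_fun do rewrite big_nil; exact: Ck_cst.
under eq_fun do rewrite big_cons.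
by case Pi: (P i) => //; apply: CkM => //; exact: fk.
Qed.

Lemma smooth_rderive U f v : smooth U f -> smooth U (rderive v f).
Proof. by move=> fs k; exact: ((fs k.+1).2 v).2. Qed.

Lemma smooth_is_rderive U f v z : smooth U f -> U z ->
  is_rderive v f z (rderive v f z).
Proof. by move=> fs; exact: (@Ck_rderivable 0). Qed.

Lemma smooth_det m U (A : Cn -> 'M[C]_m) : open U ->
  (forall a b, smooth U (fun y => A y a b)) -> smooth U (fun y => \det (A y)).
Proof.
move=> oU As k; apply: Ck_sum => // s _; apply: CkM => //; first exact: Ck_cst.
by apply: Ck_prod => // a _; exact: As.
Qed.

(** Cramer's formula: the entries are cofactors divided by a determinant without zeros on [U]. *)
Lemma smooth_invmx m U (A : Cn -> 'M[C]_m) : open U ->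
  (forall z, U z -> A z \in unitmx) ->
  (forall a b, smooth U (fun y => A y a b)) ->
  forall a b, smooth U (fun y => invmx (A y) a b).
Proof.
move=> oU Au As a b k.
apply: (Ck_ext (f := fun y => (\det (A y))^-1 * cofactor (A y) b a)) => //.
  by move=> z Uz; rewrite /invmx Au // !mxE.
have d0 z : U z -> \det (A z) != 0 by move=> /Au; rewrite unitmxE unitfE.
apply: (CkM oU (CkV oU d0 (smooth_det oU As k))).
apply: CkM => //; first exact: Ck_cst.
have Ms c d : smooth U (fun y => row' b (col' a (A y)) c d).
  by under eq_fun do rewrite !mxE; exact: As.
exact: (smooth_det oU Ms k).
Qed.

End SmoothCalculus.

(** * Gram matrices and orthonormal bases *)

Section Gram.
Variables (R : realType) (V : lmodType R[i]) (m : nat) (b : 'I_m -> V).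
Local Notation C := R[i].
Implicit Types (h : {dot V for Num.conj}) (c : 'rV[C]_m).

Lemma dotDl h u v w : h (u + v) w = h u w + h v w.
Proof. by rewrite linearDl. Qed.

Lemma dotDr h u v w : h w (u + v) = h w u + h w v.
Proof. by rewrite linearDr. Qed.

Lemma dotZl h (a : C) u w : h (a *: u) w = a * h u w.
Proof. by rewrite linearZl_LR. Qed.

Lemma dotZr h (a : C) u w : h w (a *: u) = Num.conj a * h w u.
Proof. by rewrite linearZr_LR. Qed.

Lemma dotNl h u w : h (- u) w = - h u w.
Proof. by rewrite -scaleN1r dotZl mulN1r. Qed.

Lemma dot_conj h u v : h u v = Num.conj (h v u).
Proof. by rewrite hermC expr0 mul1r. Qed.

Lemma dot_suml h (I : Type) (r : seq I) (P : pred I) (F : I -> V) w :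
  h (\sum_(i <- r | P i) F i) w = \sum_(i <- r | P i) h (F i) w.
Proof. by rewrite linear_sumlz. Qed.

Lemma dot_sumr h (I : Type) (r : seq I) (P : pred I) (F : I -> V) w :
  h w (\sum_(i <- r | P i) F i) = \sum_(i <- r | P i) h w (F i).
Proof. by rewrite linear_sumr. Qed.

Lemma dot_inj h u v : (forall w, h u w = h v w) -> u = v.
Proof.
move=> uv; apply/eqP; rewrite -subr_eq0 -(dnorm_eq0 h).
by rewrite dotDl dotNl uv subrr.
Qed.

Definition gram h : 'M[C]_m := \matrix_(i, j) h (b i) (b j).

Definition lincomb c : V := \sum_i c 0 i *: b i.

Hypothesis b_free : forall c, lincomb c = 0 -> c = 0.

Lemma lincomb_dot h c j : h (lincomb c) (b j) = (c *m gram h) 0 j.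
Proof. by rewrite dot_suml mxE; apply: eq_bigr => i _; rewrite dotZl mxE. Qed.

(** A row of the kernel gives a combination of the [b j] orthogonal to each of them, hence to
    itself; definiteness and freeness make it zero. *)
Lemma gram_unit h : gram h \in unitmx.
Proof.
rewrite -row_free_unit -kermx_eq0; apply/eqP/row_matrixP => i; rewrite row0.
apply: b_free; apply/eqP; rewrite -(dnorm_eq0 h) {2}/lincomb dot_sumr big1 // => j _.
rewrite dotZr lincomb_dot; have : row i (kermx (gram h)) *m gram h = 0.
  by apply: sub_kermxP; exact: row_sub.
by move=> ->; rewrite [X in _ * X]mxE mulr0.
Qed.

(** The Riesz vector of the functional with values [c 0 j] on [b j]. Its explicit form serves both
    existence (adjoints, Chern connection) and smoothness. *)
Definition riesz h c : V := lincomb (c *m invmx (gram h)).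

Lemma rieszP h c j : h (riesz h c) (b j) = c 0 j.
Proof. by rewrite lincomb_dot mulmxKV ?gram_unit. Qed.

End Gram.

Section OrthonormalBasis.
Variables (R : realType) (n : nat).
Local Notation C := R[i].
Local Notation Cn := 'rV[R[i]]_n.
Implicit Types (g : {dot Cn for Num.conj}) (Z : 'M[C]_n) (v : Cn).

Lemma orthonormal_seq_exists g k : (k <= n)%N ->
  exists2 S : seq Cn, size S = k & orthonormal g S.
Proof.
elim: k => [|k IH] kn; first by exists [::].
have [S Sk oS] := IH (ltnW kn).
(* A Gram-Schmidt step: [k < n] vectors cannot span, and the component orthogonal to [S] of a vector
   outside their span is normalized. *)
have [v vS] : exists v, v \notin <<S>>%VS.
  apply: contrapT => /forallNP H.
  have : (fullv <= <<S>>)%VS by apply/subvP => v _; have /negP := H v; rewrite negbK.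
  move=> /dimvS; rewrite dimvf /dim /= mul1n => nd.
  have := leq_trans nd (dim_span S); rewrite Sk => nk.
  by have := leq_trans kn nk; rewrite ltnn.
have [x xS [y [vE _ oyS]]] := orthogonal_split g S v.
have y0 : y != 0.
  by apply: contraNneq vS => y0; rewrite vE y0 addr0.
pose e := (sqrtC (g y y))^-1 *: y.
exists (e :: S); first by rewrite /= Sk.
have gyy0 : sqrtC (g y y) != 0 by rewrite sqrtC_eq0 dnorm_eq0.
have ge : g e e = 1.
  rewrite /e dnormZ normfV ger0_norm ?sqrtC_ge0 ?dnorm_ge0 //.
  by rewrite exprVn sqrtCK mulVf // dnorm_eq0.
rewrite /orthonormal /= ge eqxx andbT /=.
move: oS; rewrite /orthonormal => /andP[S1 S2]; apply/and3P; split => //.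
apply/allP => z zS /=; rewrite /e dotZl.
move/orthoPl: oyS => /(_ z zS) ->; by rewrite mulr0.
Qed.

Lemma orthonormal_basis_exists g : exists Z, orthonormal_basis g Z.
Proof.
have [S Sn oS] := orthonormal_seq_exists g (leqnn n).
exists (\matrix_a S`_a) => a b; rewrite !rowK.
have /orthonormalP[uS SP] := oS.
by rewrite SP ?mem_nth ?Sn // nth_uniq ?Sn.
Qed.

Lemma orthonormal_basis_unit g Z : orthonormal_basis g Z -> Z \in unitmx.
Proof.
move=> oZ; rewrite -row_free_unit -kermx_eq0; apply/eqP/row_matrixP => i; rewrite row0.
set u := row i _; have uZ : u *m Z = 0 by apply: sub_kermxP; exact: row_sub.
apply/rowP => b; rewrite [RHS]mxE.
have : g (u *m Z) (row b Z) = 0 by rewrite uZ linear0l.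
rewrite mulmx_sum_row dot_suml (bigD1 b) //= dotZl oZ eqxx mulr1 big1 ?addr0 //.
by move=> a /negbTE ab; rewrite dotZl oZ ab mulr0.
Qed.

Lemma orthonormal_basis_expand g Z v : orthonormal_basis g Z ->
  v = \sum_a g v (row a Z) *: row a Z.
Proof.
move=> oZ; have ZU := orthonormal_basis_unit oZ.
have vE : v = \sum_a (v *m invmx Z) 0 a *: row a Z.
  by rewrite -mulmx_sum_row mulmxKV.
rewrite {1}vE; apply: eq_bigr => b _; congr (_ *: _).
rewrite {2}vE dot_suml (bigD1 b) //= dotZl oZ eqxx mulr1 big1 ?addr0 //.
by move=> a /negbTE ab; rewrite dotZl oZ ab mulr0.
Qed.

Definition stdgram g : 'M[C]_n := gram (fun j => delta_mx 0 j) g.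

Lemma stdgram_unit g : stdgram g \in unitmx.
Proof.
apply: gram_unit => c; rewrite /lincomb => c0; apply/rowP => j.
have := congr1 (fun u : Cn => u 0 j) c0; rewrite summxE [RHS]mxE mxE => <-.
rewrite (bigD1 j) //= big1 => [|i /negbTE ij].
  by rewrite !mxE !eqxx mulr1 addr0.
by rewrite !mxE eqxx (eq_sym j) ij mulr0.
Qed.

Lemma stdgramE g u v : g u v = (u *m stdgram g *m (map_mx Num.conj v)^T) 0 0.
Proof.
rewrite {1}(row_sum_delta u) dot_suml -mulmxA mxE; apply: eq_bigr => i _.
rewrite dotZl; congr (_ * _).
rewrite {1}(row_sum_delta v) dot_sumr mxE; apply: eq_bigr => j _.
by rewrite dotZr !mxE mulrC.
Qed.

(** Orthonormality reads [Z G Z^* = 1], so [Z^* Z] is [G^-1]: expressions in [Z^* Z] do not depend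
    on the chosen basis and vary smoothly with [G]. *)
Lemma orthonormal_basis_gramV g Z : orthonormal_basis g Z ->
  invmx (stdgram g) = (map_mx Num.conj Z)^T *m Z.
Proof.
move=> oZ; have ZU := orthonormal_basis_unit oZ.
have ZGZ : Z *m (stdgram g *m (map_mx Num.conj Z)^T) = 1%:M.
  apply/matrixP => a b; rewrite mulmxA [RHS]mxE -oZ stdgramE -row_mul mxE [RHS]mxE.
  by apply: eq_bigr => k _; congr (_ * _); rewrite !mxE.
have := mulmx1C ZGZ; rewrite -mulmxA => H.
by rewrite -[LHS]mulmx1 -H mulKmx // stdgram_unit.
Qed.

End OrthonormalBasis.

(** * The strong maximum principle *)

(** The first derivative [psi] vanishes at the maximum. If [c] were positive, [psi] would be
    positive just to the right of 0, and the mean value theorem would produce a larger value of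
    [phi] there. *)
Lemma second_derivative_test (R : realType) (phi psi : R -> R) (c : R) :
  (\forall t \near (0 : R), is_derive t (1 : R) phi (psi t)) ->
  is_derive (0 : R) (1 : R) psi c ->
  (\forall t \near (0 : R), phi t <= phi 0) -> c <= 0.
Proof.
move=> dphi dpsi pmax.
have [e /= e0 He] : exists2 e : R, 0 < e & forall t, `|t| < e ->
    is_derive t (1 : R) phi (psi t) /\ phi t <= phi 0.
  have : nbhs (0 : R) [set t | is_derive t (1 : R) phi (psi t) /\ phi t <= phi 0].
    by near=> t; split; near: t.
  move=> /nbhs_ballP[e /= e0 He].
  by exists e => // t te; apply: He; rewrite /ball /= sub0r normrN.
have itvP t : t \in `](- e), e[%R -> `|t| < e by rewrite in_itv /= ltr_norml.
have psi0 : psi 0 = 0.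
  have d0 : is_derive (0 : R) (1 : R) phi 0.
    apply: (@derive1_at_max _ phi (- e) e) => [|t /itvP/He[[]] //||t /itvP/He[]//].
    - by rewrite ge0_cp // ltW.
    - by rewrite in_itv /= oppr_lt0 e0.
  have [|dp _] := He 0; first by rewrite normr0.
  by rewrite -(@derive_val _ _ _ _ _ _ _ dp) (@derive_val _ _ _ _ _ _ _ d0).
rewrite leNgt; apply/negP => c0.
have [d /= d0 Hd] : exists2 d : R, 0 < d & forall t, 0 < t < d -> 0 < psi t.
  have [dr dv] := dpsi.
  have : \forall h \near (0 : R)^', 0 < h^-1 *: (psi (h *: 1 + 0) - psi 0).
    have : (fun h => h^-1 *: ((psi \o shift 0) (h *: 1) - psi 0)) @ (0 : R)^' --> c.
      by rewrite -dv; exact: dr.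
    by move/cvgr_gt; apply.
  move=> /nbhs_ballP[d /= d0 Hd]; exists d => // t /andP[t0 td].
  have := Hd t; rewrite /ball /= sub0r normrN gtr0_norm // => /(_ td (lt0r_neq0 t0)).
  by rewrite psi0 subr0 addr0 /GRing.scale /= mulr1 pmulr_rgt0 ?invr_gt0.
pose s := Num.min d e / 2.
have s0 : 0 < s by rewrite divr_gt0 // lt_min d0 e0.
have sm : s < Num.min d e by rewrite /s gtr_pMr ?lt_min ?d0 ?e0 // invf_lt1 // ltr1n.
have /andP[sd se] : (s < d) && (s < e) by rewrite -lt_min.
have in_e t : 0 <= t <= s -> `|t| < e.
  by move=> /andP[t0 ts]; rewrite ger0_norm //; exact: le_lt_trans ts se.
have dsub (t : R) : 0 <= t <= s -> is_derive t (1 : R) phi (psi t).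
  by move=> /in_e/He[].
have [t /[!in_itv] /= /andP[t0 ts]||x /[!in_itv] /= /andP[x0 xs] E] :=
  @MVT R phi psi 0 s s0.
- by apply: dsub; rewrite !ltW.
- apply: derivable_within_continuous => t; rewrite in_itv /= => /dsub dt.
  exact: (@ex_derive _ _ _ _ _ _ _ dt).
have : 0 < psi x * s by rewrite mulr_gt0 // Hd // x0 (lt_trans xs sd).
rewrite subr0 in E; rewrite -E subr_gt0 ltNge.
have se' : `|s| < e by apply: in_e; rewrite lexx ltW.
by have [_ ->] := He s se'.
Unshelve. all: by end_near. Qed.

Section RealLines.
Variables (R : realType) (n : nat).
Local Notation C := R[i].
Local Notation Cn := 'rV[R[i]]_n.
Implicit Types (U : set Cn) (f : Cn -> C) (z v w y : Cn).

Lemma Re_continuous : continuous (fun x : C => complex.Re x).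
Proof.
move=> x; apply/(@cvgrPdist_lt _ _ _ (nbhs x)) => e e0.
near=> y; rewrite -cReN -cReD -ltcR; apply: le_lt_trans (normc_ge_Re _) _.
by near: y; apply: cvgr_dist_lt; [exact: cvg_id|rewrite ltcR].
Unshelve. all: by end_near. Qed.

Lemma Im_continuous : continuous (fun x : C => complex.Im x).
Proof.
move=> x; have -> : (fun x : C => complex.Im x) = (fun x : C => complex.Re (- 'i%C * x)).
  by apply/funext => y; rewrite cReM /= oppr0 mul0r sub0r mulN1r opprK.
apply: continuous_comp; last exact: Re_continuous.
by apply: continuousM; [exact: cst_continuous|exact: cvg_id].
Qed.

Lemma Re_smooth_continuous U f z : smooth U f -> U z ->
  {for z, continuous (fun y => complex.Re (f y))}.
Proof.
move=> fs Uz; apply: continuous_comp; last exact: Re_continuous.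
exact: (Ck_cont (fs 0%N) Uz).
Qed.

Lemma is_rderive_line v f z t l : is_rderive v f (z + t%:C *: v) l ->
  is_cderive (fun s => f (z + s%:C *: v)) t l.
Proof.
have sh (F : R -> R) d : is_derive (0 : R) (1 : R) (fun s => F (t + s)) d ->
    is_derive t (1 : R) F d.
  move=> dF.
  have d1 : is_derive t (1 : R) (shift (- t)) (1 : R) by exact: is_derive_shift.
  have dF' : is_derive (shift (- t) t) (1 : R) (fun s => F (t + s)) d.
    by rewrite /= subrr.
  apply: is_derive_ext (is_derive1_comp dF' d1) => [s|]; last by rewrite mulr1.
  by rewrite /= addrC subrK.
move=> [fr fi]; split; apply: sh.
- by apply: is_derive_ext fr => [s|]; rewrite -?addrA -?scalerDl -?raddfD.
- by apply: is_derive_ext fi => [s|]; rewrite -?addrA -?scalerDl -?raddfD.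
Qed.

Lemma smooth_coord (j : 'I_n) : smooth setT (fun y : Cn => y 0 j).
Proof.
have cc z : {for z, continuous (fun y : Cn => y 0 j)} by exact: coord_continuous.
case=> [|k]; first by split.
apply: Ck_step => [||v]; [exact: openT|by []|].
exists (fun=> v 0 j); first by apply: Ck_cst; exact: openT.
move=> z _.
have := is_cderiveD (is_cderive_cst (z 0 j) 0)
  (is_cderiveM (is_cderive_ofreal (@is_derive_id _ _ (0 : R) (1 : R)))
     (is_cderive_cst (v 0 j) 0)).
by apply: is_cderive_ext => [t|]; rewrite ?mxE // mulr0 addr0 add0r mul1r.
Qed.

End RealLines.

(** The quadratic [q] is a squared distance restricted to a line, by [sqn_line]; this is the
    derivative of a Gaussian along that line. *)
Lemma is_derive_gauss (R : realType) (eta a A B C' t : R) :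
  let q := fun t : R => A + 2 * B * t + C' * t ^+ 2 in
  is_derive t (1 : R) (fun t => eta * expR (- a * q t))
    (- a * (2 * B + 2 * C' * t) * (eta * expR (- a * q t))).
Proof.
move=> q; have scE (x y : R) : x *: y = x * y by [].
have dq : is_derive t (1 : R) (fun t => - a * q t) (- a * (2 * B + 2 * C' * t)).
  have did := @is_derive_id R R t (1 : R).
  have := is_deriveZ (- a) (is_deriveD (is_derive_cst A t (1 : R))
    (is_deriveD (is_deriveZ (2 * B) did) (is_deriveZ C' (is_deriveX 2 did)))).
  apply: is_derive_ext => [s|].
    change (- a * (A + (2 * B * s + C' * s ^+ 2)) =
      - a * (A + 2 * B * s + C' * s ^+ 2) :> R); ring.
  by rewrite !scE /=; ring.
have := is_deriveZ eta (is_derive1_comp (is_derive_expR _) dq).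
by apply: is_derive_ext => // ; rewrite !scE /=; ring.
Qed.

(** * The Gaussian barrier and its second derivatives *)

Section Barrier.
Variables (R : realType) (n : nat).
Local Notation C := R[i].
Local Notation Cn := 'rV[R[i]]_n.
Local Notation "''[' u , v ]" := (@dotmx R[i] n u v) : ring_scope.
Implicit Types (U : set Cn) (f : Cn -> C) (z v w y : Cn) (Z : 'M[C]_n).

Definition sqn v : R := complex.Re '[v, v].

Lemma sqnE v : sqn v = \sum_j (complex.Re (v 0 j) ^+ 2 + complex.Im (v 0 j) ^+ 2).
Proof.
rewrite /sqn dotmxE mxE (big_morph _ (@cReD R) (erefl : complex.Re 0 = 0)).
apply: eq_bigr => j _; rewrite !mxE.
case: (v 0 j) => [a b]; rewrite cReM cRe_conj cIm_conj /=; ring.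
Qed.

Lemma sqn_ge0 v : 0 <= sqn v.
Proof. by rewrite sqnE sumr_ge0 // => j _; rewrite addr_ge0 ?sqr_ge0. Qed.

Lemma sqnN v : sqn (- v) = sqn v.
Proof. by rewrite /sqn linearNl linearNr opprK. Qed.

(** Stands in for the triangle inequality and keeps square roots out of the estimates. *)
Lemma sqnD_le v w : sqn (v + w) <= 2 * sqn v + 2 * sqn w.
Proof.
rewrite !sqnE !mulr_sumr -big_split /=; apply: ler_sum => j _.
rewrite mxE cReD cImD.
set a := complex.Re (v 0 j); set b := complex.Re (w 0 j).
set c := complex.Im (v 0 j); set d := complex.Im (w 0 j).
have := sqr_ge0 (a - b); have := sqr_ge0 (c - d); nra.
Qed.

Fact sqn_line_algebra (x y r : C) (t : R) :
  complex.Re (x + t%:C * y + (t%:C * Num.conj y + t%:C * (t%:C * r))) =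
  complex.Re x + 2 * complex.Re y * t + complex.Re r * t ^+ 2.
Proof. by rewrite !(cReD, cReM, cImM, cRe_conj, cIm_conj) /=; ring. Qed.

Lemma sqn_line v w (t : R) :
  sqn (v + t%:C *: w) = sqn v + 2 * complex.Re '[v, w] * t + sqn w * t ^+ 2.
Proof.
rewrite /sqn dotDl !dotDr !dotZl !dotZr (dot_conj _ w v).
have -> : Num.conj t%:C = t%:C :> C by exact: conjc_real.
exact: sqn_line_algebra.
Qed.

Lemma Re_dot_i v w : complex.Re '[v, 'i *: w] = complex.Im '[v, w].
Proof.
rewrite dotZr -complexiE cReM cRe_conj cIm_conj /=.
by rewrite mul0r mulN1r sub0r opprK.
Qed.

Lemma sqn_i w : sqn ('i *: w) = sqn w.
Proof.
rewrite /sqn dotZl dotZr -complexiE.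
rewrite !(cReD, cReM, cImM, cRe_conj, cIm_conj) /=; ring.
Qed.

Fact gauss_algebra (a b k e x : R) :
  - a * (2 * b) * (- a * (2 * b) * (e * x)) + e * x * (- a * (2 * k)) =
  e * x * (4 * a ^+ 2 * b ^+ 2 - 2 * a * k).
Proof. by ring. Qed.

(** Hopf's barrier, without the customary subtracted constant, which neither derivatives nor
    differences of values detect. *)
Definition barrier (a : R) y z : R := expR (- a * sqn (z - y)).

(** The second derivative test on the line [z + t w]. The bracket is the second derivative of the
    barrier along that line, divided by its value. *)
Lemma barrier_local_max U f z y w (a eta : R) : open U -> U z -> smooth U f ->
  (\forall x \near z, complex.Re (f x) + eta * barrier a y x
                      <= complex.Re (f z) + eta * barrier a y z) ->
  complex.Re (rderive w (rderive w f) z)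
  + eta * barrier a y z * (4 * a ^+ 2 * complex.Re '[z - y, w] ^+ 2 - 2 * a * sqn w)
  <= 0.
Proof.
move=> oU Uz fs fmax.
set A := sqn (z - y); set B := complex.Re '[z - y, w]; set K := sqn w.
pose q := fun t : R => A + 2 * B * t + K * t ^+ 2.
pose b := fun t => eta * expR (- a * q t).
have bE t : b t = eta * barrier a y (z + t%:C *: w).
  by rewrite /b /barrier addrAC sqn_line.
pose phi := fun t : R => complex.Re (f (z + t%:C *: w)) + b t.
pose psi := fun t : R => complex.Re (rderive w f (z + t%:C *: w))
   + - a * (2 * B + 2 * K * t) * b t.
apply: (@second_derivative_test _ phi psi).
- have nU : nbhs z U by exact: open_nbhs_nbhs.
  apply: filterS (near_line w nU) => t Ut.
  have [dfr _] := is_rderive_line (smooth_is_rderive w fs Ut).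
  exact: is_deriveD dfr (is_derive_gauss eta a A B K t).
- have [dr _] : is_rderive w (rderive w f) z (rderive w (rderive w f) z).
    exact: (smooth_is_rderive w (smooth_rderive w fs) Uz).
  have dl : is_derive (0 : R) (1 : R) (fun t : R => - a * (2 * B + 2 * K * t))
      (- a * (2 * K)).
    have := is_deriveZ (- a) (is_deriveD (is_derive_cst (2 * B) (0 : R) (1 : R))
      (is_deriveZ (2 * K) (@is_derive_id _ _ (0 : R) (1 : R)))).
    apply: is_derive_ext => //.
    change (- a * (0 + 2 * K * 1) = - a * (2 * K) :> R); ring.
  have db := is_derive_gauss eta a A B K 0.
  apply: is_derive_ext (is_deriveD dr (is_deriveM dl db)) => //.
  congr (_ + _); rewrite /barrier -/A /GRing.scale /=.
  have q0 : A + 2 * B * 0 + K * 0 ^+ 2 = A by rewrite mulr0 expr0n mulr0 !addr0.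
  by rewrite q0 mulr0 addr0 gauss_algebra.
- apply: filterS (near_line w fmax) => t /=.
  by rewrite /phi !bE line0.
Qed.

Lemma barrier_algebra (X Y a eta b p q r : R) :
  X + eta * b * (4 * a ^+ 2 * p ^+ 2 - 2 * a * r) <= 0 ->
  Y + eta * b * (4 * a ^+ 2 * q ^+ 2 - 2 * a * r) <= 0 ->
  X + Y + 4 * eta * b * a * (a * (p ^+ 2 + q ^+ 2) - r) <= 0.
Proof.
move=> H1 H2; have := lerD H1 H2; rewrite addr0; apply: le_trans.
by rewrite le_eqVlt; apply/orP; left; apply/eqP; ring.
Qed.

(** Testing along both [w] and ['i *: w] completes the squared real part of the product with [w] to
    a squared modulus, so the factor of [a] becomes the quadratic form of the operator. *)
Lemma barrier_laplacian U f z y Z (a eta : R) : open U -> U z -> smooth U f ->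
  (\forall x \near z, complex.Re (f x) + eta * barrier a y x
                      <= complex.Re (f z) + eta * barrier a y z) ->
  \sum_a (complex.Re (rderive (row a Z) (rderive (row a Z) f) z) +
     complex.Re (rderive ('i *: row a Z) (rderive ('i *: row a Z) f) z))
  + 4 * eta * barrier a y z * a * (a *
    (\sum_a (complex.Re '[z - y, row a Z] ^+ 2 + complex.Im '[z - y, row a Z] ^+ 2))
    - \sum_a sqn (row a Z))
  <= 0.
Proof.
move=> oU Uz fs fmax.
rewrite mulr_sumr -sumrB mulr_sumr -big_split /=; apply: sumr_le0 => c _.
set w := row c Z.
have H1 := barrier_local_max w oU Uz fs fmax.
have H2 := barrier_local_max ('i *: w) oU Uz fs fmax.
rewrite (Re_dot_i (z - y) w) (sqn_i w) in H2.
exact: (barrier_algebra H1 H2).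
Qed.

End Barrier.

Section StrongMaximum.
Variables (R : realType) (n : nat).
Local Notation C := R[i].
Local Notation Cn := 'rV[R[i]]_n.
Local Notation "''[' u , v ]" := (@dotmx R[i] n u v) : ring_scope.
Implicit Types (U : set Cn) (f : Cn -> C) (z v w y p : Cn) (Z : 'M[C]_n).

Lemma smooth_quadratic U y (M : Cn -> 'M[C]_n) : open U ->
  (forall a b, smooth U (fun z => M z a b)) ->
  smooth U (fun z => ((z - y) *m M z *m (map_mx Num.conj (z - y))^T) 0 0).
Proof.
move=> oU Ms k.
have cs j : Ck k U (fun z : Cn => z 0 j - y 0 j).
  apply: CkD => //; last exact: Ck_cst.
  by apply: Ck_sub (@smooth_coord _ _ j k).
apply: (Ck_ext (f := fun z => \sum_b (\sum_a (z 0 a - y 0 a) * M z a b) *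
   Num.conj (z 0 b - y 0 b))) => //.
  move=> z _; rewrite mxE; apply: eq_bigr => b _; rewrite !mxE; congr (_ * _).
  by apply: eq_bigr => a _; rewrite !mxE.
apply: Ck_sum => // b _; apply: CkM => //; last exact: Ck_conj.
by apply: Ck_sum => // a _; apply: CkM => //; exact: Ms.
Qed.

Lemma sqn_continuous y : continuous (fun z => sqn (z - y)).
Proof.
move=> z.
have s1 : smooth setT (fun z => ((z - y) *m 1%:M *m (map_mx Num.conj (z - y))^T) 0 0).
  apply: smooth_quadratic => [|a b k]; first exact: openT.
  by apply: Ck_cst; exact: openT.
have -> : (fun z => sqn (z - y)) = fun z =>
    complex.Re (((z - y) *m 1%:M *m (map_mx Num.conj (z - y))^T) 0 0).
  by apply/funext => x; rewrite mulmx1 /sqn dotmxE map_trmx.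
exact: (Re_smooth_continuous s1 (I : setT z)).
Qed.

(** The topology of row vectors comes from the sup norm, whereas the level sets of the barrier are
    Euclidean spheres. *)
Lemma nbhs_sqn U p : nbhs p U ->
  exists2 r : R, 0 < r & forall z, sqn (z - p) < r -> U z.
Proof.
move=> /nbhs_ballP[e /= e0 pU].
have eE : e = (complex.Re e)%:C by rewrite RRe_real ?gtr0_real.
have r0 : 0 < complex.Re e by rewrite -ltcR -eE.
exists (complex.Re e ^+ 2); first by rewrite exprn_gt0.
move=> z zr; apply: pU; split => // i j; rewrite -ball_normE /= ord1.
rewrite distrC -(ltr_pXn2r (n := 2)) ?nnegrE ?normr_ge0 ?(ltW e0) //.
rewrite -add_Re2_Im2 eE -rmorphXn ltcR; apply: le_lt_trans zr.
rewrite sqnE (bigD1 j) //= !mxE lerDl sumr_ge0 // => k _.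
by rewrite addr_ge0 ?sqr_ge0.
Qed.

Lemma compact_sqn y (r : R) : compact [set z | sqn (z - y) <= r].
Proof.
(* Chosen so that [r <= s ^+ 2]: each coordinate of [z - y] then lies in the square of half-side
   [s], and the set is closed in a product of compact squares. *)
pose s := `|r| + 1.
pose F j (q : R * R) : C := y 0 j + (q.1%:C + 'i * q.2%:C).
pose B j := F j @` (`[- s, s] `*` `[- s, s]).
have FC j : continuous (F j).
  move=> q.
  have cc (a : C) : {for q, continuous (fun _ : R * R => a)} by exact: cst_continuous.
  have c1 : {for q, continuous (fun q : R * R => q.1%:C)}.
    by apply: continuous_comp; [exact: cvg_fst|exact: real_complex_continuous].
  have c2 : {for q, continuous (fun q : R * R => q.2%:C)}.
    by apply: continuous_comp; [exact: cvg_snd|exact: real_complex_continuous].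
  exact: (continuousD (cc (y 0 j)) (continuousD c1 (continuousM (cc 'i) c2))).
have Bc j : compact (B j).
  apply: continuous_compact; first exact: continuous_subspaceT.
  by apply: compact_setX; exact: segment_compact.
apply: subclosed_compact (rV_compact Bc) _.
  apply: (preimage_closed _ (@closed_le _ r)) => z _; exact: sqn_continuous.
move=> z /= zr j.
exists (complex.Re (z 0 j - y 0 j), complex.Im (z 0 j - y 0 j)); last first.
  by rewrite /F /= -complexiE -complexE addrC subrK.
have zj : complex.Re (z 0 j - y 0 j) ^+ 2 + complex.Im (z 0 j - y 0 j) ^+ 2 <= r.
  apply: le_trans zr; rewrite sqnE (bigD1 j) //= !mxE lerDl sumr_ge0 // => k _.
  by rewrite addr_ge0 ?sqr_ge0.
have rs : r <= s ^+ 2 by rewrite /s; have := ler_norm r; have := normr_ge0 r; nra.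
have s0 : 0 <= s by rewrite addr_ge0.
split; rewrite /= in_itv /= -ler_norml -(ler_pXn2r (n := 2)) ?nnegrE //
    real_normK ?num_real //;
  apply: le_trans rs; apply: le_trans zj; rewrite ?lerDl ?lerDr sqr_ge0 //.
Qed.

Lemma orthonormal_trace (g : {dot Cn for Num.conj}) Z : orthonormal_basis g Z ->
  complex.Re (\tr (invmx (stdgram g))) = \sum_a sqn (row a Z).
Proof.
move=> oZ; rewrite (orthonormal_basis_gramV oZ) mxtrace_mulC /mxtrace.
rewrite (big_morph _ (@cReD R) (erefl : complex.Re 0 = 0)).
apply: eq_bigr => a _; rewrite /sqn dotmxE; congr complex.Re.
by rewrite !mxE; apply: eq_bigr => j _; rewrite !mxE.
Qed.

Lemma orthonormal_quadratic (g : {dot Cn for Num.conj}) Z v : orthonormal_basis g Z ->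
  complex.Re ((v *m invmx (stdgram g) *m (map_mx Num.conj v)^T) 0 0) =
  \sum_a (complex.Re '[v, row a Z] ^+ 2 + complex.Im '[v, row a Z] ^+ 2).
Proof.
move=> oZ; rewrite (orthonormal_basis_gramV oZ) mulmxA -mulmxA mxE.
rewrite (big_morph _ (@cReD R) (erefl : complex.Re 0 = 0)).
apply: eq_bigr => a _.
have -> : (v *m (map_mx Num.conj Z)^T) 0 a = '[v, row a Z].
  by rewrite dotmxE !mxE; apply: eq_bigr => j _; rewrite !mxE.
have -> : (Z *m (map_mx Num.conj v)^T) a 0 = '[row a Z, v].
  by rewrite dotmxE !mxE; apply: eq_bigr => j _; rewrite !mxE.
have -> : '[row a Z, v] = Num.conj '[v, row a Z] by exact: dot_conj.
by rewrite cReM cRe_conj cIm_conj mulrN opprK -!expr2.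
Qed.

(** Ellipticity of the operator: a zero [v] of the form is orthogonal, for the standard product, to
    all the rows of an invertible matrix. *)
Lemma orthonormal_quadratic_gt0 (g : {dot Cn for Num.conj}) v : v != 0 ->
  0 < complex.Re ((v *m invmx (stdgram g) *m (map_mx Num.conj v)^T) 0 0).
Proof.
move=> v0; have [Z oZ] := orthonormal_basis_exists g.
rewrite (orthonormal_quadratic v oZ) lt_def sumr_ge0 ?andbT; last first.
  by move=> a _; rewrite addr_ge0 ?sqr_ge0.
apply: contra v0; rewrite psumr_eq0 => [|a _]; last by rewrite addr_ge0 ?sqr_ge0.
move=> /allP H; have vZ : v *m (map_mx Num.conj Z)^T = 0.
  apply/rowP => a; rewrite [RHS]mxE.
  have -> : (v *m (map_mx Num.conj Z)^T) 0 a = '[v, row a Z].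
    by rewrite dotmxE !mxE; apply: eq_bigr => j _; rewrite !mxE.
  apply/eqP; apply: contraT => /sqr_norm_neq0.
  by rewrite (eqP (H a _)) ?eqxx // mem_index_enum.
have ZU : (map_mx Num.conj Z)^T \in unitmx.
  by rewrite unitmx_tr map_unitmx (orthonormal_basis_unit oZ).
by rewrite -(mulmxK ZU v) vZ mul0mx.
Qed.

End StrongMaximum.

Lemma compact_max (T : topologicalType) (R : realType) (A : set T) (F : T -> R) :
  A !=set0 -> compact A -> (forall x, A x -> {for x, continuous F}) ->
  exists2 c, A c & forall x, A x -> F x <= F c.
Proof.
move=> A0 cA Fc.
have [|c /set_mem Ac cmax] := @compact_EVT_max _ _ F A A0 cA.
  by apply: continuous_in_subspaceT => x /set_mem; exact: Fc.
by exists c => // x /mem_set; exact: cmax.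
Qed.

Lemma compact_min (T : topologicalType) (R : realType) (A : set T) (F : T -> R) :
  A !=set0 -> compact A -> (forall x, A x -> {for x, continuous F}) ->
  exists2 c, A c & forall x, A x -> F c <= F x.
Proof.
move=> A0 cA Fc.
have [|c /set_mem Ac cmin] := @compact_EVT_min _ _ F A A0 cA.
  by apply: continuous_in_subspaceT => x /set_mem; exact: Fc.
by exists c => // x /mem_set; exact: cmin.
Qed.

Lemma sqn0 (R : realType) n : sqn (0 : 'rV[R[i]]_n) = 0.
Proof. by rewrite /sqn linear0l. Qed.

Opaque sqn.
Section StrongMaximum.
Variables (R : realType) (n : nat).
Local Notation C := R[i].
Local Notation Cn := 'rV[R[i]]_n.
Implicit Types (U : set Cn) (f : Cn -> C) (z v w y p : Cn) (Z : 'M[C]_n).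

Lemma barrier_le1 (a : R) y z : 0 <= a -> barrier a y z <= 1.
Proof.
by move=> a0; rewrite /barrier -expR0 ler_expR mulNr oppr_le0 mulr_ge0 // sqn_ge0.
Qed.

Lemma barrier_gt0 (a : R) y z : 0 < barrier a y z.
Proof. exact: expR_gt0. Qed.

Lemma barrier_lt (a : R) y z p : 0 < a -> sqn (p - y) < sqn (z - y) ->
  barrier a y z < barrier a y p.
Proof.
move=> a0 pz; have na0 : - a < 0 by rewrite oppr_lt0.
by rewrite /barrier ltr_expR (ltr_nM2l na0).
Qed.

Lemma barrier_continuous (a : R) y : continuous (barrier a y).
Proof.
move=> z; apply: continuous_comp; last exact: continuous_expR.
apply: continuousM; [exact: cst_continuous|exact: sqn_continuous].
Qed.

Opaque barrier rderive.

Fact lt_half_gap (u w : R) : u < w -> u < w - (w - u) / 2.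
Proof. by move=> *; lra. Qed.

Fact lt_sixteenth (r u : R) : 0 < r -> u < r / 16 -> u < r.
Proof. by move=> *; lra. Qed.

Fact lt_quarter (r u : R) : 0 < r -> u < r / 16 -> u < r / 4.
Proof. by move=> *; lra. Qed.

Fact radius_sum (r u v : R) : 0 < r -> u <= r / 4 -> v < r / 16 -> 2 * u + 2 * v < r.
Proof. by move=> *; lra. Qed.

Fact inner_contra (u v w m e : R) :
  u < m - e -> w <= e -> 0 < v -> m + v <= u + w -> False.
Proof. by move=> *; lra. Qed.

Fact outer_contra (u v w m : R) : u <= m -> m + v <= u + w -> w < v -> False.
Proof. by move=> *; lra. Qed.

(** Suppose [f y < f p] for some [y] near [p], and add to [f] a small barrier centred at [y]. Over a
    ball about [y] containing [p], the sum is maximal neither near [y], where [f] is too small, nor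
    on the boundary, where the barrier is smaller than at [p]. At an interior maximum the operator
    is nonpositive on the sum, yet it is nonnegative on [f] and positive on the barrier. *)
Theorem strong_maximum U p f (g : Cn -> {dot Cn for Num.conj}) :
  open U -> U p -> smooth U f ->
  (forall u v, smooth U (fun z => g z u v)) ->
  (forall z Z, U z -> orthonormal_basis (g z) Z ->
     0 <= \sum_a (complex.Re (rderive (row a Z) (rderive (row a Z) f) z) +
       complex.Re (rderive ('i *: row a Z) (rderive ('i *: row a Z) f) z))) ->
  (forall z, U z -> complex.Re (f z) <= complex.Re (f p)) ->
  \forall z \near p, complex.Re (f z) = complex.Re (f p).
Proof.
move=> oU Up fs gs fsub fmax.
have fc z (Uz : U z) := Re_smooth_continuous fs Uz.
have [r r0 rU] := nbhs_sqn (open_nbhs_nbhs (conj oU Up)).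
(* With this bound, the ball of squared radius [r / 4] about [y] has [p] in its interior and, as
   [2 * (r / 4) + 2 * (r / 16) < r], lies in [U]. *)
have : \forall y \near p, sqn (y - p) < r / 16.
  have : sqn (z - p) @[z --> p] --> sqn (p - p) by exact: sqn_continuous.
  by move/cvgr_lt; apply; rewrite subrr sqn0 divr_gt0.
apply: filterS => y yp.
have sC a b : sqn (a - b) = sqn (b - a) by rewrite -sqnN opprB.
have Uy : U y by apply: rU; exact: (lt_sixteenth r0 yp).
have py : sqn (p - y) < r / 16 by rewrite sC.
apply/eqP; rewrite eq_le fmax //= leNgt; apply/negP => fy.
set M := complex.Re (f p) in fy fmax.
(* Half the gap, so that [f] stays below [M - d] on a whole neighbourhood of [y]. *)
pose d := (M - complex.Re (f y)) / 2.
have d0 : 0 < d by rewrite divr_gt0 // subr_gt0.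
have fyd : complex.Re (f y) < M - d.
  exact: lt_half_gap.
have [e e0 He] : exists2 e, 0 < e & forall z, sqn (z - y) < e -> complex.Re (f z) < M - d.
  have H : \forall z \near y, complex.Re (f z) < M - d.
    have : complex.Re (f z) @[z --> y] --> complex.Re (f y) by exact: fc.
    by move/cvgr_lt; apply.
  exact: nbhs_sqn H.
pose K := [set z | sqn (z - y) <= r / 4].
have KU z : K z -> U z.
  move=> Kz; apply: rU; rewrite -(subrK y z) -addrA.
  exact: le_lt_trans (sqnD_le _ _) (radius_sum r0 Kz yp).
(* The quadratic form in [z - y] vanishes at [y]; without a small ball about [y] it has a positive
   minimum. *)
pose K' := K `&` [set z | e <= sqn (z - y)].
have K'p : K' p.
  split; first by rewrite /K /= ltW // lt_quarter.
  by rewrite /= leNgt; apply/negP => /He; rewrite -/M ltNge gerBl ltW.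
have K'c : compact K'.
  apply: (@subclosed_compact _ K' K); [|exact: compact_sqn|by move=> z []].
  apply: closedI.
    by apply: (preimage_closed _ (@closed_le _ (r / 4))) => z _; exact: sqn_continuous.
  by apply: (preimage_closed _ (@closed_ge _ e)) => z _; exact: sqn_continuous.
have Gs : forall a b, smooth U (fun z => invmx (stdgram (g z)) a b).
  apply: smooth_invmx => // [z _|a b]; first exact: stdgram_unit.
  by under eq_fun do rewrite mxE; exact: gs.
(* For every g_z-orthonormal basis (Z_a), Q z is the sum of the |<z - y, Z_a>|^2
   and T z the sum of the |Z_a|^2; in terms of the Gram matrix both are visibly
   continuous. The operator applied to the barrier is positive where T < a Q. *)
pose Q z := complex.Re
  (((z - y) *m invmx (stdgram (g z)) *m (map_mx Num.conj (z - y))^T) 0 0).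
pose T z := complex.Re (\tr (invmx (stdgram (g z)))).
have Qc z : U z -> {for z, continuous Q}.
  by apply: Re_smooth_continuous; exact: smooth_quadratic.
have Tc z : U z -> {for z, continuous T}.
  apply: Re_smooth_continuous => k; apply: Ck_sum => // a _; exact: Gs.
have K'0 : K' !=set0 by exists p.
have [c K'c1 cmin] := compact_min K'0 K'c (fun z K'z => Qc z (KU z K'z.1)).
have [c2 K'c2 cmax] := compact_max K'0 K'c (fun z K'z => Tc z (KU z K'z.1)).
have Qc0 : 0 < Q c.
  apply: orthonormal_quadratic_gt0; apply: contraTneq (K'c1.2) => /= ->.
  by rewrite -ltNge sqn0.
(* On [K'] one has [Q c <= Q] and [T <= T c2], so this value forces [T < a * Q] throughout. *)
pose a := (`|T c2| + 1) / Q c.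
have a0 : 0 < a by rewrite divr_gt0 // ltr_wpDl.
have psic t : K t -> {for t, continuous (fun t => complex.Re (f t) + d * barrier a y t)}.
  move=> /KU Ut; apply: continuousD; first exact: fc.
  by apply: continuousM; [exact: cst_continuous|exact: barrier_continuous].
have K0 : K !=set0 by exists p; case: K'p.
have [z Kz zmax] := compact_max K0 (@compact_sqn _ _ y (r / 4)) psic.
have pz := zmax p K'p.1; rewrite -/M in pz.
have Uz := KU _ Kz.
have fz := fmax z Uz.
have bz := barrier_le1 y z (ltW a0).
have bp := barrier_gt0 a y p.
(* Near [y] the sum is below [M - d + d], the barrier being at most 1, while at [p] it exceeds
   [M]. *)
have ez : e <= sqn (z - y).
  rewrite leNgt; apply/negP => /He fz'.
  have dz : d * barrier a y z <= d by rewrite ger_pMr.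
  have dp : 0 < d * barrier a y p by rewrite mulr_gt0.
  exact: inner_contra fz' dz dp pz.
(* On the boundary sphere [f] is at most [M] and the barrier is smaller than at [p], which is closer
   to [y]. *)
have zr : sqn (z - y) < r / 4.
  rewrite lt_def Kz andbT; apply/eqP => zr.
  have bzp : barrier a y z < barrier a y p.
    by apply: barrier_lt; rewrite // -zr lt_quarter.
  rewrite -(ltr_pM2l d0) in bzp.
  exact: outer_contra fz pz bzp.
have [Z oZ] := orthonormal_basis_exists (g z).
have Kn : \forall x \near z, K x.
  have : sqn (x - y) @[x --> z] --> sqn (z - y) by exact: sqn_continuous.
  by move/cvgr_lt => /(_ _ zr); apply: filterS => x /ltW.
have L := barrier_laplacian Z oU Uz fs (filterS (fun x Kx => zmax x Kx) Kn).
rewrite -(orthonormal_quadratic _ oZ) -(orthonormal_trace oZ) -/(Q z) -/(T z) in L.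
have K'z : K' z by split.
have QT : 0 < a * Q z - T z.
  rewrite subr_gt0; apply: le_lt_trans (cmax z K'z) _.
  apply: lt_le_trans (_ : a * Q c <= _); last first.
    by rewrite ler_pM2l //; exact: (cmin z K'z).
  by rewrite /a divfK ?gt_eqF // (le_lt_trans (ler_norm _)) // ltrDl.
have {}L := L (nbhs_filter z).
suff : 0 < 4 * d * barrier a y z * a * (a * Q z - T z).
  by move=> /(ltr_wpDl (fsub z Z Uz oZ)) /lt_le_trans/(_ L); rewrite ltxx.
by rewrite mulr_gt0 // mulr_gt0 // mulr_gt0 ?barrier_gt0 // mulr_gt0.
Qed.

End StrongMaximum.

(** * Wirtinger derivatives *)

Section DirectionLinearity.
Variables (R : realType) (n : nat).
Local Notation C := R[i].
Local Notation Cn := 'rV[R[i]]_n.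
Implicit Types (U : set Cn) (f : Cn -> C) (z v w y p a : Cn).

Lemma is_derive_right (F : R -> R) l : is_derive (0 : R) (1 : R) F l ->
  (fun h => h^-1 * (F h - F 0)) @ (0 : R)^'+ --> l.
Proof.
move=> [dF <-]; apply: cvg_dnbhs_at_right.
have -> : (fun h => h^-1 * (F h - F 0)) =
    (fun h => h^-1 *: ((F \o shift 0) (h *: (1 : R)) - F 0)).
  by apply/funext => h; rewrite /GRing.scale /= mulr1 addr0.
exact: dF.
Qed.

(** By the mean value theorem along [w] from the moving point [z + t v], the quotient is a value of
    [G] at some [z + t v + s w] with [0 < s < t], which tends to [z]. *)
Lemma increment_cvg (F G : Cn -> R) z v w :
  (\forall y \near z, is_derive (0 : R) (1 : R) (fun t : R => F (y + t%:C *: w)) (G y)) ->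
  {for z, continuous G} ->
  (fun t : R => t^-1 * (F (z + t%:C *: v + t%:C *: w) - F (z + t%:C *: v)))
    @ (0 : R)^'+ --> G z.
Proof.
move=> dF Gc; apply/cvgrPdist_lt => e e0.
have plane : continuous (fun q : R * R => z + q.1%:C *: v + q.2%:C *: w).
  move=> q.
  have c1 : {for q, continuous (fun q : R * R => q.1%:C)}.
    by apply: continuous_comp; [exact: cvg_fst|exact: real_complex_continuous].
  have c2 : {for q, continuous (fun q : R * R => q.2%:C)}.
    by apply: continuous_comp; [exact: cvg_snd|exact: real_complex_continuous].
  apply: cvgD; last exact: cvgZr_tmp c2.
  apply: cvgD; [exact: cvg_cst|exact: cvgZr_tmp c1].
have W : \forall y \near z,
    is_derive (0 : R) (1 : R) (fun t : R => F (y + t%:C *: w)) (G y) /\ `|G z - G y| < e.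
  have Ge : \forall y \near z, `|G z - G y| < e.
    by move/cvgrPdist_lt : Gc; apply.
  by near=> y; split; near: y.
have : nbhs ((0 : R), (0 : R)) (fun q : R * R =>
    is_derive (0 : R) (1 : R) (fun t : R => F (z + q.1%:C *: v + q.2%:C *: w + t%:C *: w))
      (G (z + q.1%:C *: v + q.2%:C *: w))
    /\ `|G z - G (z + q.1%:C *: v + q.2%:C *: w)| < e).
  have := plane (0, 0); rewrite /continuous_at /= !line0 => /(_ _ W); exact.
move=> /nbhs_ballP[d /= d0 Hd].
near=> t.
have t0 : 0 < t by near: t; exact: nbhs_right_gt.
have td : t < d by near: t; exact: nbhs_right_lt.
have inside s : 0 <= s <= t -> ball ((0 : R), (0 : R)) d (t, s).
  move=> /andP[s0 st]; split; rewrite /ball /= sub0r normrN ger0_norm // ?ltW //.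
  exact: le_lt_trans td.
have dh s : 0 <= s <= t -> is_derive s (1 : R) (fun s => F (z + t%:C *: v + s%:C *: w))
    (G (z + t%:C *: v + s%:C *: w)).
  move=> /inside/Hd[/= H _].
  have := @is_rderive_line _ _ w (fun y => (F y)%:C) (z + t%:C *: v) s
    (G (z + t%:C *: v + s%:C *: w))%:C.
  by case=> //; split => //=; exact: is_derive_cst.
have [s|s|s] := @MVT R (fun s => F (z + t%:C *: v + s%:C *: w))
  (fun s => G (z + t%:C *: v + s%:C *: w)) 0 t t0.
- by rewrite in_itv /= => /andP[s0 st]; apply: dh; rewrite !ltW.
- apply: derivable_within_continuous => x; rewrite in_itv /= => /dh dx.
  exact: (@ex_derive _ _ _ _ _ _ _ dx).
rewrite in_itv /= => /andP[s0 st]; rewrite line0 subr0 => ->.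
rewrite mulrC mulfK ?gt_eqF //.
by have [] := Hd (t, s) (inside s _); rewrite ?ltW.
Unshelve. all: by end_near. Qed.

(** Derivatives along lines through one point need not be additive in the direction. Here the
    increment along [v + w] is cut into one along [v] from [z] and one along [w] from [z + t v], and
    continuity of [G] controls the latter. *)
Lemma derive_line_additive (F G : Cn -> R) z v w l m :
  is_derive (0 : R) (1 : R) (fun t : R => F (z + t%:C *: v)) l ->
  is_derive (0 : R) (1 : R) (fun t : R => F (z + t%:C *: (v + w))) m ->
  (\forall y \near z, is_derive (0 : R) (1 : R) (fun t : R => F (y + t%:C *: w)) (G y)) ->
  {for z, continuous G} -> m = l + G z.
Proof.
move=> /is_derive_right Fl /is_derive_right Fm dF Gc.
have Fs := cvgD Fl (increment_cvg v dF Gc).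
suff Fs' : (fun h => h^-1 * (F (z + h%:C *: (v + w)) - F (z + (0 : R)%:C *: (v + w))))
    @ (0 : R)^'+ --> l + G z by exact: (cvg_unique _ Fm Fs').
refine (cvg_trans (near_eq_cvg _) (Fs _)); near=> h.
rewrite /= !line0 -mulrDr; congr (_ * _).
by rewrite addrC subrKA scalerDr addrA.
Unshelve. all: by end_near. Qed.

Lemma rderiveD U f z v w : open U -> U z -> smooth U f ->
  rderive (v + w) f z = rderive v f z + rderive w f z.
Proof.
move=> oU Uz fs.
have [vr vi] := smooth_is_rderive v fs Uz.
have [pr pi] := smooth_is_rderive (v + w) fs Uz.
have nU : nbhs z U by exact: open_nbhs_nbhs.
have wc : {for z, continuous (rderive w f)} := Ck_cont (smooth_rderive w fs 0%N) Uz.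
apply: complex_eqP; rewrite ?cReD ?cImD.
- apply: (derive_line_additive (F := fun y => complex.Re (f y)) (w := w) vr pr
    (G := fun y => complex.Re (rderive w f y))).
    by apply: filterS nU => y Uy; have [] := smooth_is_rderive w fs Uy.
  by apply: continuous_comp; [exact: wc|exact: Re_continuous].
- apply: (derive_line_additive (F := fun y => complex.Im (f y)) (w := w) vi pi
    (G := fun y => complex.Im (rderive w f y))).
    by apply: filterS nU => y Uy; have [] := smooth_is_rderive w fs Uy.
  by apply: continuous_comp; [exact: wc|exact: Im_continuous].
Qed.

Lemma is_rderiveZdir f z v l (a : R) : is_rderive v f z l ->
  is_rderive (a%:C *: v) f z (l * a%:C).
Proof.
have sc (F : R -> R) d : is_derive (0 : R) (1 : R) F d ->
    is_derive (0 : R) (1 : R) (fun t => F (t * a)) (d * a).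
  move=> dF.
  have da : is_derive (0 : R) (1 : R) (fun t => t * a) a.
    apply: is_derive_ext (is_deriveZ a (@is_derive_id _ _ (0 : R) (1 : R))) => [t|].
      by rewrite mulrC.
    by rewrite /GRing.scale /= mulr1.
  have dF' : is_derive ((fun t : R => t * a) 0) (1 : R) F d by rewrite /= mul0r.
  by apply: is_derive_ext (@is_derive1_comp R F (fun t => t * a) 0 d a dF' da).
move=> [fr fi]; split.
- apply: is_derive_ext (sc _ _ fr) => [t|]; first by rewrite scalerA -rmorphM.
  by rewrite cReM /= mulr0 subr0.
- apply: is_derive_ext (sc _ _ fi) => [t|]; first by rewrite scalerA -rmorphM.
  by rewrite cImM /= mulr0 add0r.
Qed.

Lemma rderiveZ U f z v (a : R) : U z -> smooth U f ->
  rderive (a%:C *: v) f z = a%:C * rderive v f z.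
Proof.
move=> Uz fs; rewrite mulrC; apply: is_rderive_rderive.
by apply: is_rderiveZdir; exact: smooth_is_rderive fs Uz.
Qed.

Lemma rderive0 U f z : U z -> smooth U f -> rderive 0 f z = 0.
Proof.
by move=> Uz fs; rewrite -(scale0r (0 : Cn)) (rderiveZ 0 (0 : R) Uz fs) mul0r.
Qed.

Lemma rderive_dirsum U f z v : open U -> U z -> smooth U f ->
  rderive v f z = \sum_j ((complex.Re (v 0 j))%:C * rderive (delta_mx 0 j) f z +
     (complex.Im (v 0 j))%:C * rderive ('i *: delta_mx 0 j) f z).
Proof.
move=> oU Uz fs.
have D v' w' : rderive (v' + w') f z = rderive v' f z + rderive w' f z.
  exact: rderiveD oU Uz fs.
rewrite {1}(row_sum_delta v) (big_morph (fun v => rderive v f z) D (rderive0 Uz fs)).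
apply: eq_bigr => j _.
rewrite {1}(complexE (v 0 j)) scalerDl D (rderiveZ _ _ Uz fs) -complexiE.
by rewrite (mulrC 'i) -scalerA (rderiveZ _ _ Uz fs).
Qed.

Definition delb (b : Cn) f z : C := \sum_j b 0 j * ddzb j f z.

Lemma rderive_i_dirsum U f z v : open U -> U z -> smooth U f ->
  rderive ('i *: v) f z = \sum_j (- (complex.Im (v 0 j))%:C * rderive (delta_mx 0 j) f z +
     (complex.Re (v 0 j))%:C * rderive ('i *: delta_mx 0 j) f z).
Proof.
move=> oU Uz fs; rewrite (rderive_dirsum _ oU Uz fs); apply: eq_bigr => j _.
rewrite mxE -complexiE; case: (v 0 j) => a b /=.
by rewrite !mul0r !mul1r sub0r add0r rmorphN.
Qed.

(** The coordinate-free form of the Wirtinger derivative. It links the Bochner identity to the real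
    second derivatives of the maximum principle. *)
Lemma delE U f z a : open U -> U z -> smooth U f ->
  del a f z = 2%:R^-1 * (rderive a f z - 'i * rderive ('i *: a) f z).
Proof.
move=> oU Uz fs.
rewrite (rderive_dirsum _ oU Uz fs) (rderive_i_dirsum _ oU Uz fs).
rewrite mulr_sumr -sumrB mulr_sumr; apply: eq_bigr => j _.
rewrite /ddz {1}(complexE (a 0 j)) -complexiE.
have ii : 'i%C * 'i%C = -1 :> C by rewrite -expr2 sqr_i.
move: (rderive (delta_mx 0 j) f z) (rderive ('i%C *: delta_mx 0 j) f z) => p q.
move: (complex.Re (a 0 j))%:C (complex.Im (a 0 j))%:C 'i%C ii (2%:R^-1) => x y i ii h.
transitivity (h * (x * p - i * x * q + i * y * p - (i * i) * y * q)); first by ring.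
by rewrite ii; ring.
Qed.

Lemma delbE U f z a : open U -> U z -> smooth U f ->
  delb (conjv a) f z = 2%:R^-1 * (rderive a f z + 'i * rderive ('i *: a) f z).
Proof.
move=> oU Uz fs.
rewrite (rderive_dirsum _ oU Uz fs) (rderive_i_dirsum _ oU Uz fs).
rewrite mulr_sumr -big_split mulr_sumr; apply: eq_bigr => j _ /=.
rewrite /ddzb mxE {1}(complexE (a 0 j)) -complexiE.
have ii : 'i%C * 'i%C = -1 :> C by rewrite -expr2 sqr_i.
have -> : Num.conj ((complex.Re (a 0 j))%:C + 'i%C * (complex.Im (a 0 j))%:C) =
   (complex.Re (a 0 j))%:C - 'i%C * (complex.Im (a 0 j))%:C.
  by case: (a 0 j) => x y; apply: complex_eqP;
    rewrite !(cRe_conj, cIm_conj, cReD, cImD, cReN, cImN, cReM, cImM) /=; ring.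
move: (rderive (delta_mx 0 j) f z) (rderive ('i%C *: delta_mx 0 j) f z) => p q.
move: (complex.Re (a 0 j))%:C (complex.Im (a 0 j))%:C 'i%C ii (2%:R^-1) => x y i ii h.
transitivity (h * (x * p + i * x * q - i * y * p - (i * i) * y * q)); last first.
  by rewrite ii; ring.
by ring.
Qed.

End DirectionLinearity.

Opaque rderive.

(** * Product, conjugation and sum rules for Wirtinger derivatives *)

Section Leibniz.
Variables (R : realType) (n : nat).
Local Notation C := R[i].
Local Notation Cn := 'rV[R[i]]_n.
Implicit Types (U V : set Cn) (f g : Cn -> C) (z v w a b : Cn).

Lemma ddz_near j f g z : {near z, f =1 g} -> ddz j f z = ddz j g z.
Proof. by move=> fg; rewrite /ddz (rderive_near _ fg) (rderive_near ('i *: _) fg). Qed.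

Lemma ddzb_near j f g z : {near z, f =1 g} -> ddzb j f z = ddzb j g z.
Proof. by move=> fg; rewrite /ddzb (rderive_near _ fg) (rderive_near ('i *: _) fg). Qed.

Lemma del_near a f g z : {near z, f =1 g} -> del a f z = del a g z.
Proof. by move=> fg; apply: eq_bigr => j _; rewrite (ddz_near _ fg). Qed.

Lemma delb_near b f g z : {near z, f =1 g} -> delb b f z = delb b g z.
Proof. by move=> fg; apply: eq_bigr => j _; rewrite (ddzb_near _ fg). Qed.

Fact leibniz_minus (h c p q p' q' F G : C) :
  h * ((p * G + F * q) - c * (p' * G + F * q'))
  = h * (p - c * p') * G + F * (h * (q - c * q')).
Proof. by ring. Qed.

Fact leibniz_plus (h c p q p' q' F G : C) :
  h * ((p * G + F * q) + c * (p' * G + F * q'))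
  = h * (p + c * p') * G + F * (h * (q + c * q')).
Proof. by ring. Qed.

Fact leibniz_weight (c p q F G : C) :
  c * (p * G + F * q) = c * p * G + F * (c * q).
Proof. by ring. Qed.

Lemma ddzM U f g z j : smooth U f -> smooth U g -> U z ->
  ddz j (fun y => f y * g y) z = ddz j f z * g z + f z * ddz j g z.
Proof.
move=> fs gs Uz; rewrite /ddz.
have D v := is_rderive_rderive
  (is_rderiveM (smooth_is_rderive v fs Uz) (smooth_is_rderive v gs Uz)).
rewrite (D (delta_mx 0 j)) (D ('i *: delta_mx 0 j)).
exact: leibniz_minus.
Qed.

Lemma ddzbM U f g z j : smooth U f -> smooth U g -> U z ->
  ddzb j (fun y => f y * g y) z = ddzb j f z * g z + f z * ddzb j g z.
Proof.
move=> fs gs Uz; rewrite /ddzb.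
have D v := is_rderive_rderive
  (is_rderiveM (smooth_is_rderive v fs Uz) (smooth_is_rderive v gs Uz)).
rewrite (D (delta_mx 0 j)) (D ('i *: delta_mx 0 j)).
exact: leibniz_plus.
Qed.

Fact wirtinger_conj (p q : C) :
  2%:R^-1 * (Num.conj p - 'i * Num.conj q) = Num.conj (2%:R^-1 * (p + 'i * q)).
Proof.
rewrite (rmorphM Num.conj) (rmorphD Num.conj) (rmorphM Num.conj) fmorphV rmorph_nat.
by rewrite /= conjCi mulNr.
Qed.

Lemma ddz_conj U f z j : smooth U f -> U z ->
  ddz j (fun y => Num.conj (f y)) z = Num.conj (ddzb j f z).
Proof.
move=> fs Uz; rewrite /ddz /ddzb.
have D v := is_rderive_rderive (is_rderive_conj (smooth_is_rderive v fs Uz)).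
rewrite (D (delta_mx 0 j)) (D ('i *: delta_mx 0 j)).
exact: wirtinger_conj.
Qed.

Lemma ddz_sum (I : Type) (r : seq I) (P : pred I) U (F : I -> Cn -> C) z j :
  (forall i, P i -> smooth U (F i)) -> U z ->
  ddz j (fun y => \sum_(i <- r | P i) F i y) z = \sum_(i <- r | P i) ddz j (F i) z.
Proof.
move=> Fs Uz; rewrite /ddz.
have D v := is_rderive_rderive
  (is_rderive_sum r (fun i Pi => smooth_is_rderive v (Fs i Pi) Uz)).
by rewrite (D (delta_mx 0 j)) (D ('i *: delta_mx 0 j)) mulr_sumr -sumrB mulr_sumr.
Qed.

Lemma ddzb_sum (I : Type) (r : seq I) (P : pred I) U (F : I -> Cn -> C) z j :
  (forall i, P i -> smooth U (F i)) -> U z ->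
  ddzb j (fun y => \sum_(i <- r | P i) F i y) z = \sum_(i <- r | P i) ddzb j (F i) z.
Proof.
move=> Fs Uz; rewrite /ddzb.
have D v := is_rderive_rderive
  (is_rderive_sum r (fun i Pi => smooth_is_rderive v (Fs i Pi) Uz)).
by rewrite (D (delta_mx 0 j)) (D ('i *: delta_mx 0 j)) mulr_sumr -big_split mulr_sumr.
Qed.

Lemma ddzb_cst (c : C) z j : ddzb j (fun=> c) z = 0.
Proof.
by rewrite /ddzb !(is_rderive_rderive (is_rderive_cst _ c z)) mulr0 addr0 mulr0.
Qed.

Lemma delM U f g z a : smooth U f -> smooth U g -> U z ->
  del a (fun y => f y * g y) z = del a f z * g z + f z * del a g z.
Proof.
move=> fs gs Uz; rewrite /del mulr_suml mulr_sumr -big_split; apply: eq_bigr => j _ /=.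
by rewrite (ddzM _ fs gs Uz) leibniz_weight.
Qed.

Lemma delbM U f g z b : smooth U f -> smooth U g -> U z ->
  delb b (fun y => f y * g y) z = delb b f z * g z + f z * delb b g z.
Proof.
move=> fs gs Uz; rewrite /delb mulr_suml mulr_sumr -big_split; apply: eq_bigr => j _ /=.
by rewrite (ddzbM _ fs gs Uz) leibniz_weight.
Qed.

Lemma conjvE a j : conjv a 0 j = Num.conj (a 0 j).
Proof. by rewrite mxE. Qed.

Lemma del_conj U f z a : smooth U f -> U z ->
  del a (fun y => Num.conj (f y)) z = Num.conj (delb (conjv a) f z).
Proof.
move=> fs Uz; rewrite /del /delb rmorph_sum; apply: eq_bigr => j _ /=.
by rewrite (ddz_conj _ fs Uz) [RHS]rmorphM /= conjvE conjCK.
Qed.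

Lemma del_sum (I : Type) (r : seq I) (P : pred I) U (F : I -> Cn -> C) z a :
  (forall i, P i -> smooth U (F i)) -> U z ->
  del a (fun y => \sum_(i <- r | P i) F i y) z = \sum_(i <- r | P i) del a (F i) z.
Proof.
move=> Fs Uz; rewrite /del exchange_big; apply: eq_bigr => j _ /=.
by rewrite (ddz_sum _ _ Fs Uz) mulr_sumr.
Qed.

Lemma delb_sum (I : Type) (r : seq I) (P : pred I) U (F : I -> Cn -> C) z b :
  (forall i, P i -> smooth U (F i)) -> U z ->
  delb b (fun y => \sum_(i <- r | P i) F i y) z = \sum_(i <- r | P i) delb b (F i) z.
Proof.
move=> Fs Uz; rewrite /delb exchange_big; apply: eq_bigr => j _ /=.
by rewrite (ddzb_sum _ _ Fs Uz) mulr_sumr.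
Qed.

Lemma delb_cst (c : C) z b : delb b (fun=> c) z = 0.
Proof. by rewrite /delb big1 // => j _; rewrite ddzb_cst mulr0. Qed.

Lemma del0 f z : del 0 f z = 0.
Proof. by rewrite /del big1 // => j _; rewrite mxE mul0r. Qed.

Lemma delb0 f z : delb 0 f z = 0.
Proof. by rewrite /delb big1 // => j _; rewrite mxE mul0r. Qed.

Lemma conjv0 : conjv (0 : Cn) = 0.
Proof. exact: raddf0. Qed.

Lemma conjvK : involutive (@conjv R n).
Proof. by move=> a; apply/rowP => j; rewrite !mxE conjCK. Qed.

Lemma smooth_sub U V f : V `<=` U -> smooth U f -> smooth V f.
Proof. by move=> VU fs k; exact: Ck_sub VU (fs k). Qed.

Lemma smooth_cst U (c : C) : open U -> smooth U (fun=> c).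
Proof. by move=> oU k; exact: Ck_cst. Qed.

Lemma smooth_mul U f g : open U -> smooth U f -> smooth U g ->
  smooth U (fun y => f y * g y).
Proof. by move=> oU fs gs k; exact: CkM. Qed.

Lemma smooth_add U f g : open U -> smooth U f -> smooth U g ->
  smooth U (fun y => f y + g y).
Proof. by move=> oU fs gs k; exact: CkD. Qed.

Lemma smooth_conj U f : open U -> smooth U f -> smooth U (fun y => Num.conj (f y)).
Proof. by move=> oU fs k; exact: Ck_conj. Qed.

Lemma smooth_sum (I : Type) (r : seq I) (P : pred I) U (F : I -> Cn -> C) : open U ->
  (forall i, P i -> smooth U (F i)) -> smooth U (fun y => \sum_(i <- r | P i) F i y).
Proof. by move=> oU Fs k; apply: Ck_sum => // i Pi; exact: Fs. Qed.

Lemma smooth_ext U f g : open U -> (forall z, U z -> f z = g z) ->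
  smooth U f -> smooth U g.
Proof. by move=> oU fg fs k; exact: Ck_ext fg (fs k). Qed.

End Leibniz.

(** * The Chern connection in a chart *)

Opaque rderive ddz ddzb.

Section ExtBasis.
Variables (R : realType) (n : nat).
Local Notation C := R[i].
Local Notation Cn := 'rV[R[i]]_n.
Local Notation E := (ext R n).
Implicit Types (w y u : E) (Z : Cn) (S T A : {set 'I_n}).

Definition extb S : E := [ffun T => (T == S)%:R].

Definition extbi (i : 'I_#|{set 'I_n}|) : E := extb (enum_val i).

Lemma ext_expand u : u = \sum_S u S *: extb S.
Proof.
apply/ffunP => T; rewrite sum_ffunE (bigD1 T) //= big1 ?addr0.
  by rewrite !ffunE eqxx [RHS]mulr1.
by move=> S /negbTE ST; rewrite !ffunE eq_sym ST [LHS]mulr0.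
Qed.

Lemma extbi_free (c : 'rV[C]_(#|{set 'I_n}|)) : lincomb extbi c = 0 -> c = 0.
Proof.
move=> c0; apply/rowP => i; rewrite [RHS]mxE.
have := congr1 (fun u : E => u (enum_val i)) c0; rewrite sum_ffunE ffunE => <-.
rewrite (bigD1 i) //= big1 ?addr0; first by rewrite !ffunE eqxx [RHS]mulr1.
by move=> j /negbTE ij; rewrite !ffunE (inj_eq enum_val_inj) eq_sym ij [LHS]mulr0.
Qed.

Lemma dot_expand (h : {dot E for Num.conj}) u v :
  h u v = \sum_S Num.conj (v S) * h u (extb S).
Proof.
by rewrite {1}(ext_expand v) dot_sumr; apply: eq_bigr => S _; rewrite dotZr.
Qed.

(** The Riesz vector, tested on the frame, inhabits the set under [xget], whose default 0 is
    therefore never returned by lack of a witness. *)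
Lemma adjointP (h : {dot E for Num.conj}) (B : {linear E -> E}) w y :
  h (adjoint h B w) y = h w (B y).
Proof.
have [u uP] : exists u, forall y, h u y = h w (B y).
  exists (riesz extbi h (\row_i h w (B (extbi i)))) => v.
  rewrite {2}(ext_expand v) linear_sum dot_sumr dot_expand; apply: eq_bigr => S _.
  rewrite linearZ dotZr; congr (_ * _).
  have {1}-> : extb S = extbi (enum_rank S) by rewrite /extbi enum_rankK.
  by rewrite (rieszP extbi_free) mxE /extbi enum_rankK.
exact: (@xgetPex _ (0 : E) [set u | forall y, h u y = h w (B y)] (ex_intro _ u uP) y).
Qed.

Lemma ext_wedge_is_linear w : linear (ext_wedge w).
Proof.
move=> a u v; apply/ffunP => S; rewrite !ffunE [X in _ = X + _]mulr_sumr -big_split.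
by apply: eq_bigr => A _ /=; rewrite !ffunE mulrDr; congr (_ + _); rewrite mulrCA.
Qed.

HB.instance Definition _ w := GRing.isLinear.Build C E E _ (ext_wedge w)
  (ext_wedge_is_linear w).

Lemma ext_wedge0l u : ext_wedge 0 u = 0.
Proof. by apply/ffunP => S; rewrite !ffunE big1 // => A _; rewrite ffunE mulr0 mul0r. Qed.

Lemma ext_wedgeDl (a : C) w y u :
  ext_wedge (a *: w + y) u = a *: ext_wedge w u + ext_wedge y u.
Proof.
apply/ffunP => S; rewrite !ffunE [X in _ = X + _]mulr_sumr -big_split.
by apply: eq_bigr => A _ /=; rewrite !ffunE; rewrite /GRing.scale /=; ring.
Qed.

Lemma ext_contractDl (a : C) Z Z' w :
  ext_contract (a *: Z + Z') w = a *: ext_contract Z w + ext_contract Z' w.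
Proof.
apply/ffunP => S; rewrite !ffunE [X in _ = X + _]mulr_sumr -big_split.
by apply: eq_bigr => b _ /=; rewrite !mxE; ring.
Qed.

Lemma ext_contract0l w : ext_contract 0 w = 0.
Proof. by apply/ffunP => S; rewrite !ffunE big1 // => A _; rewrite mxE mulr0 mul0r. Qed.

End ExtBasis.

Section Chern.
Variables (R : realType) (n : nat).
Local Notation C := R[i].
Local Notation Cn := 'rV[R[i]]_n.
Local Notation E := (ext R n).
Variables (h : Cn -> {dot E for Num.conj}) (U : set Cn).
Hypotheses (oU : open U) (hs : forall u v, smooth U (fun z => h z u v)).
Implicit Types (V : set Cn) (s t : Cn -> E) (z a b Z : Cn).

Definition smooth_comps V s := forall S, smooth V (fun z => s z S).

Lemma smooth_comps_sub V s : V `<=` U -> smooth_comps U s -> smooth_comps V s.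
Proof. by move=> VU ss S; exact: smooth_sub VU (ss S). Qed.

Lemma smooth_pairing V s t : open V -> V `<=` U -> smooth_comps V s -> smooth_comps V t ->
  smooth V (fun z => h z (s z) (t z)).
Proof.
move=> oV VU ss ts.
have E0 : (fun z => h z (s z) (t z)) =
   (fun z => \sum_S Num.conj (t z S) * \sum_T s z T * h z (extb R T) (extb R S)).
  apply/funext => z; rewrite dot_expand; apply: eq_bigr => S _; congr (_ * _).
  by rewrite {1}(ext_expand (s z)) dot_suml; apply: eq_bigr => T _; rewrite dotZl.
rewrite E0; apply: smooth_sum => // S _; apply: smooth_mul => //.
  by apply: smooth_conj.
apply: smooth_sum => // T _; apply: smooth_mul => //.
exact: smooth_sub VU (hs _ _).
Qed.

Lemma dbarE b s z S : dbar b s z S = delb b (fun y => s y S) z.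
Proof. by rewrite ffunE. Qed.

Lemma dbar_near b s t z : {near z, s =1 t} -> dbar b s z = dbar b t z.
Proof.
move=> st; apply/ffunP => S; rewrite !dbarE; apply: delb_near.
by apply: filterS st => y ->.
Qed.

Lemma dbar0 s z : dbar 0 s z = 0.
Proof. by apply/ffunP => S; rewrite dbarE delb0 ffunE. Qed.

(** The property under the [xget] of [del_h], isolated so that [del_h] can be evaluated on sections
    whose smoothness has not been established. *)
Definition chern_spec a s z (u : E) := forall V t, open V -> V z -> smooth_comps V t ->
    del a (fun y => h y (s y) (t y)) z = h z u (t z) + h z (s z) (dbar (conjv a) t z).

Lemma chern_spec_unique a s z u v : chern_spec a s z u -> chern_spec a s z v -> u = v.
Proof.
move=> us vs; apply: (@dot_inj _ _ (h z)) => w.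
have ws : smooth_comps setT (fun _ : Cn => w).
  by move=> S; apply: smooth_cst; exact: openT.
have := vs setT _ openT I ws; rewrite (us setT _ openT I ws).
by move/addIr.
Qed.

Lemma del_h_spec a s z u : chern_spec a s z u -> del_h h a s z = u.
Proof.
by move=> us; apply: xget_unique => // v vs; exact: chern_spec_unique vs us.
Qed.

(** The frame vectors are constant, hence killed by [dbar], so compatibility prescribes the products
    of the value with the frame; these are the Riesz data. *)
Definition chern a s z : E :=
  riesz (@extbi R n) (h z) (\row_i del a (fun y => h y (s y) (extbi R i)) z).

(** Compatibility extends from the frame to every smooth [t] by the Leibniz rule: the components of
    [t] enter [h] conjugated, and [del_conj] turns their (1,0)-derivatives into [dbar]. *)
Lemma chernP a s z : U z -> smooth_comps U s -> chern_spec a s z (chern a s z).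
Proof.
move=> Uz ss V t oV Vz ts.
set W := U `&` V; have oW : open W by exact: openI.
have Wz : W z by [].
have WU : W `<=` U by move=> ? [].
have WV : W `<=` V by move=> ? [].
have sW : smooth_comps W s by exact: smooth_comps_sub.
have bs S : smooth_comps W (fun _ : Cn => extb R S) by move=> T; exact: smooth_cst.
have hS S : smooth W (fun y => h y (s y) (extb R S)) by exact: smooth_pairing.
have tS S : smooth W (fun y => Num.conj (t y S)).
  by apply: smooth_conj => //; exact: smooth_sub WV (ts S).
have -> : (fun y => h y (s y) (t y)) =
    (fun y => \sum_S Num.conj (t y S) * h y (s y) (extb R S)).
  by apply/funext => y; rewrite -dot_expand.
rewrite (@del_sum _ _ _ _ _ W) //; last by move=> S _; exact: smooth_mul.
rewrite [h z (chern _ _ _) _]dot_expand [h z (s z) _]dot_expand -big_split.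
apply: eq_bigr => S _ /=.
rewrite (delM _ (tS S) (hS S) Wz) addrC; congr (_ + _).
  by rewrite (del_conj _ (smooth_sub WV (ts S)) Wz) dbarE.
congr (_ * _); have -> : extb R S = extbi R (enum_rank S) by rewrite /extbi enum_rankK.
by rewrite (rieszP (@extbi_free R n)) mxE.
Qed.

Lemma del_hE a s z : U z -> smooth_comps U s -> del_h h a s z = chern a s z.
Proof. by move=> Uz ss; apply: del_h_spec; exact: chernP. Qed.

Lemma del_hP a s z : U z -> smooth_comps U s -> chern_spec a s z (del_h h a s z).
Proof. by move=> Uz ss; rewrite del_hE //; exact: chernP. Qed.

(** A choice made by [xget] carries no regularity; the formula for [chern] does, through the inverse
    Gram matrix. *)
Lemma smooth_del_h a s : smooth_comps U s -> smooth_comps U (del_h h a s).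
Proof.
move=> ss S.
apply: (smooth_ext (f := fun z => chern a s z S)) => //.
  by move=> z Uz; rewrite del_hE.
have E0 : (fun z => chern a s z S) = (fun z => \sum_i (\sum_j
    del a (fun y => h y (s y) (extbi R j)) z * invmx (gram (@extbi R n) (h z)) j i)
    * extbi R i S).
  apply/funext => z; rewrite /chern /riesz /lincomb sum_ffunE; apply: eq_bigr => i _.
  rewrite ffunE [LHS]/GRing.scale /= mxE; congr (_ * _); apply: eq_bigr => j _.
  by rewrite mxE.
rewrite E0; apply: smooth_sum => // i _; apply: smooth_mul => //; last exact: smooth_cst.
apply: smooth_sum => // j _; apply: smooth_mul => //; last first.
  apply: smooth_invmx => // [z _|k l]; first exact: gram_unit (@extbi_free R n) _.
  by under eq_fun do rewrite mxE; exact: hs.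
have bs : smooth_comps U (fun _ : Cn => extbi R j) by move=> T; exact: smooth_cst.
have Hs : smooth U (fun y => h y (s y) (extbi R j)) by exact: smooth_pairing.
apply: (smooth_ext (f := fun z => 2%:R^-1 * (rderive a (fun y => h y (s y) (extbi R j)) z
   + - 'i * rderive ('i *: a) (fun y => h y (s y) (extbi R j)) z))) => //.
  by move=> z Uz; rewrite (delE _ oU Uz Hs) mulNr.
apply: smooth_mul => //; first exact: smooth_cst.
apply: smooth_add => //; first exact: smooth_rderive.
by apply: smooth_mul => //; [exact: smooth_cst|exact: smooth_rderive].
Qed.

End Chern.

(** * The Bochner identity *)

Opaque rderive ddz ddzb.

Section Higgs.
Variables (R : realType) (n : nat).
Local Notation C := R[i].
Local Notation Cn := 'rV[R[i]]_n.
Local Notation E := (ext R n).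
Variables (h : Cn -> {dot E for Num.conj}) (U : set Cn) (w : Cn -> E).
Hypotheses (oU : open U) (hs : forall u v, smooth U (fun z => h z u v)).
Hypothesis wh : forall S, holomorphic U (fun z => w z S).
Implicit Types (V : set Cn) (s t : Cn -> E) (z a b Z : Cn).

Lemma holomorphic_delb b f z : holomorphic U f -> U z -> delb b f z = 0.
Proof. by move=> [_ f0] Uz; rewrite /delb big1 // => j _; rewrite f0 // mulr0. Qed.

Lemma smooth_contract Z : smooth_comps U (fun z => ext_contract Z (w z)).
Proof.
move=> S; under eq_fun do rewrite ffunE.
apply: smooth_sum => // a _; apply: smooth_mul => //; first exact: smooth_cst.
exact: (wh _).1.
Qed.

Lemma delb_contract b Z z S : U z -> delb b (fun y => ext_contract Z (w y) S) z = 0.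
Proof.
move=> Uz; under eq_fun do rewrite ffunE.
rewrite (@delb_sum _ _ _ _ _ U) //.
  apply: big1 => a _; rewrite (@delbM _ _ U) //; last 2 first.
  - exact: smooth_cst.
  - exact: (wh _).1.
  by rewrite delb_cst mul0r add0r (holomorphic_delb _ (wh _) Uz) mulr0.
by move=> a _; apply: smooth_mul => //; [exact: smooth_cst|exact: (wh _).1].
Qed.

Lemma smooth_higgs V t Z : open V -> V `<=` U -> smooth_comps V t ->
  smooth_comps V (fun z => higgs w z Z (t z)).
Proof.
move=> oV VU ts S; rewrite /higgs; under eq_fun do rewrite ffunE.
apply: smooth_sum => // A _; apply: smooth_mul => //; apply: smooth_mul => //.
  exact: smooth_cst.
exact: smooth_sub VU (smooth_contract Z A).
Qed.

(** The Higgs field is holomorphic: for [Z] with constant coefficients, those of [theta(Z)] are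
    killed by the (0,1)-derivatives. *)
Lemma dbar_higgs V b t Z z : open V -> V `<=` U -> smooth_comps V t -> V z ->
  dbar b (fun y => higgs w y Z (t y)) z = higgs w z Z (dbar b t z).
Proof.
move=> oV VU ts Vz; apply/ffunP => S; rewrite dbarE /higgs.
under eq_fun do rewrite ffunE.
have cs A : smooth V (fun y => ext_contract Z (w y) A).
  exact: smooth_sub VU (smooth_contract Z A).
have c1s A (c : C) : smooth V (fun y => c * ext_contract Z (w y) A).
  by apply: smooth_mul => //; exact: smooth_cst.
rewrite (@delb_sum _ _ _ _ _ V) //; last by move=> A _; exact: smooth_mul.
rewrite ffunE; apply: eq_bigr => A _; rewrite dbarE.
rewrite (delbM _ (c1s _ _) (ts _) Vz) (delbM _ (smooth_cst _ oV) (cs _) Vz).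
by rewrite delb_cst delb_contract ?mulr0 ?mul0r ?addr0 ?mul0r ?add0r //; exact: VU.
Qed.

Lemma higgs_adjointP z Z u v :
  h z (adjoint (h z) (higgs w z Z) u) v = h z u (higgs w z Z v).
Proof. exact: (adjointP (h z) (ext_wedge (ext_contract Z (w z)))). Qed.

Lemma higgs0 z u : higgs w z 0 u = 0.
Proof. by rewrite /higgs ext_contract0l ext_wedge0l. Qed.

Lemma theta_bar0 z u : theta_bar h (higgs w) 0 z u = 0.
Proof.
rewrite /theta_bar conjv0; apply: (@dot_inj _ _ (h z)) => v.
by rewrite higgs_adjointP higgs0 linear0r -[0 in RHS](scale0r 0) dotZl mul0r.
Qed.

Lemma del_h0 s z : del_h h 0 s z = 0.
Proof.
apply: del_h_spec => V t _ _ _; rewrite del0 conjv0 dbar0 linear0r addr0.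
by rewrite -[0 in RHS](scale0r 0) dotZl mul0r.
Qed.

Lemma chern_spec_near a s s' z u : U z -> {near z, s =1 s'} ->
  chern_spec h a s z u -> chern_spec h a s' z u.
Proof.
move=> Uz ss' us V t oV Vz ts; rewrite -(nbhs_singleton ss') -(us V t oV Vz ts).
by apply: del_near; apply: filterS ss' => y /= ->.
Qed.

Lemma D_h10E Z s z :
  D_h h (higgs w) (Z, 0) s z = del_h h Z s z + higgs w z Z (s z).
Proof. by rewrite /D_h /D'_h /D'' /= theta_bar0 dbar0 addr0 add0r. Qed.

Lemma D_h01E b s z : D_h h (higgs w) (0, b) s z =
  adjoint (h z) (higgs w z (conjv b)) (s z) + dbar b s z.
Proof. by rewrite /D_h /D'_h /D'' /= del_h0 higgs0 addr0 add0r. Qed.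

(** The dual of [dbar_higgs]: moving [theta(Z)] to the test section [t], differentiating there and
    moving it back shows that [theta(Z)^*] commutes with the (1,0)-part of the connection.
    Smoothness of [s] and of [theta(Z) t] is all that enters. *)
Lemma chern_spec_higgs_adjoint Z s z : U z -> smooth_comps U s ->
  chern_spec h Z (fun y => adjoint (h y) (higgs w y Z) (s y)) z
    (adjoint (h z) (higgs w z Z) (del_h h Z s z)).
Proof.
move=> Uz ss V t oV Vz ts.
have oW : open (U `&` V) by exact: openI.
have WU : U `&` V `<=` U by move=> ? [].
have tW : smooth_comps (U `&` V) t by move=> S; apply: smooth_sub (ts S) => ? [].
have hts : smooth_comps (U `&` V) (fun y => higgs w y Z (t y)) by exact: smooth_higgs.
under eq_fun do rewrite higgs_adjointP.
rewrite (del_hP oU hs Z Uz ss oW (conj Uz Vz) hts) !higgs_adjointP.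
by rewrite (dbar_higgs _ _ oW WU tW (conj Uz Vz)).
Qed.

Variable s : Cn -> E.
Hypothesis sh : forall S, holomorphic U (fun z => s z S).
Hypothesis sk : forall z Z, U z -> higgs w z Z (s z) = 0.

Lemma holomorphic_smooth_comps : smooth_comps U s.
Proof. by move=> S; exact: (sh S).1. Qed.

Lemma holomorphic_dbar b z : U z -> dbar b s z = 0.
Proof.
by move=> Uz; apply/ffunP => S; rewrite dbarE (holomorphic_delb _ (sh S) Uz) ffunE.
Qed.

Lemma D_h10 Z z : U z -> D_h h (higgs w) (Z, 0) s z = del_h h Z s z.
Proof.
by move=> Uz; rewrite D_h10E sk // addr0.
Qed.

Lemma D_h01 b z : U z ->
  D_h h (higgs w) (0, b) s z = adjoint (h z) (higgs w z (conjv b)) (s z).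
Proof.
by move=> Uz; rewrite D_h01E holomorphic_dbar // addr0.
Qed.

(** Both orders of differentiation produce the term [theta(Z)^* sigma_Z], by
    [chern_spec_higgs_adjoint] for one of them, and the two copies cancel. *)
Lemma F_hE Z z : U z -> F_h h (higgs w) (Z, 0) (0, conjv Z) s z =
  higgs w z Z (adjoint (h z) (higgs w z Z) (s z)) - dbar (conjv Z) (del_h h Z s) z.
Proof.
move=> Uz; rewrite /F_h.
have nU : nbhs z U by exact: open_nbhs_nbhs.
have n01 : {near z, D_h h (higgs w) (0, conjv Z) s =1
    (fun y => adjoint (h y) (higgs w y Z) (s y))}.
  by apply: filterS nU => y Uy; rewrite D_h01 // conjvK.
have n10 : {near z, D_h h (higgs w) (Z, 0) s =1 del_h h Z s}.
  by apply: filterS nU => y; exact: D_h10.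
rewrite (D_h10E Z (D_h _ _ _ _)) (D_h01E _ (D_h _ _ _ _)).
rewrite (nbhs_singleton n01) (nbhs_singleton n10) conjvK (dbar_near _ n10).
have := chern_spec_higgs_adjoint Z Uz holomorphic_smooth_comps.
move=> /(chern_spec_near Uz (_ : {near z, _ =1 D_h h (higgs w) (0, conjv Z) s})).
move=> /(_ (filterS (fun y e => esym e) n01)) /del_h_spec ->.
by rewrite opprD addrACA subrr add0r.
Qed.

Lemma bochner Z z : U z ->
  delb (conjv Z) (del Z (fun y => h y (s y) (s y))) z =
  h z (del_h h Z s z) (del_h h Z s z)
  + h z (adjoint (h z) (higgs w z Z) (s z)) (adjoint (h z) (higgs w z Z) (s z))
  - h z (F_h h (higgs w) (Z, 0) (0, conjv Z) s z) (s z).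
Proof.
move=> Uz.
have ss := holomorphic_smooth_comps.
have nU : nbhs z U by exact: open_nbhs_nbhs.
have ds : smooth_comps U (del_h h Z s) by exact: smooth_del_h.
have UU : U `<=` U by [].
have E1 : {near z, del Z (fun y => h y (s y) (s y)) =1
    (fun y => h y (del_h h Z s y) (s y))}.
  apply: filterS nU => y Uy; rewrite (del_hP oU hs Z Uy ss oU Uy ss).
  by rewrite holomorphic_dbar // linear0r addr0.
rewrite (delb_near _ E1).
have sm : smooth U (fun y => h y (del_h h Z s y) (s y)) by exact: smooth_pairing.
have := del_conj Z sm Uz.
(* Compatibility covers (1,0)-derivatives only, so the outer (0,1)-derivative is conjugated into a
   (1,0)-derivative of [h(s, sigma_Z)]. *)
have -> : (fun y => Num.conj (h y (del_h h Z s y) (s y))) =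
    (fun y => h y (s y) (del_h h Z s y)).
  by apply/funext => y; rewrite -dot_conj.
move=> /(congr1 Num.conj); rewrite conjCK => <-.
rewrite (del_hP oU hs Z Uz ss oU Uz ds) F_hE // dotDl dotNl.
rewrite (rmorphD Num.conj) /= -!dot_conj.
have -> : h z (higgs w z Z (adjoint (h z) (higgs w z Z) (s z))) (s z) =
    h z (adjoint (h z) (higgs w z Z) (s z)) (adjoint (h z) (higgs w z Z) (s z)).
  by rewrite dot_conj -higgs_adjointP -dot_conj.
by rewrite opprB addrACA subrr addr0.
Qed.

Lemma iLambdaFE (Z : 'M[C]_n) z u : h z (iLambdaF h (higgs w) Z s z) u =
  \sum_a h z (F_h h (higgs w) (row a Z, 0) (0, conjv (row a Z)) s z) u.
Proof. by rewrite dot_suml. Qed.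

End Higgs.

(** * Comparison with real second derivatives *)

Section RealLaplacian.
Variables (R : realType) (n : nat).
Local Notation C := R[i].
Local Notation Cn := 'rV[R[i]]_n.
Implicit Types (U : set Cn) (f : Cn -> C) (z v a : Cn).

Lemma Im_rderive U f z v : open U -> U z -> smooth U f ->
  (forall y, U y -> complex.Im (f y) = 0) -> complex.Im (rderive v f z) = 0.
Proof.
move=> oU Uz fs f0; have [_ fi] := smooth_is_rderive v fs Uz.
have d0 : is_derive (0 : R) (1 : R) (fun t : R => complex.Im (f (z + t%:C *: v))) 0.
  apply: near_eq_is_derive (is_derive_cst (0 : R) (0 : R) (1 : R)).
  by apply: filterS (near_line v (open_nbhs_nbhs (conj oU Uz))) => t /f0 ->.
by rewrite -(@derive_val _ _ _ _ _ _ _ fi) (@derive_val _ _ _ _ _ _ _ d0).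
Qed.

Fact wirtinger_real (p q r t : C) : complex.Im t = 0 -> complex.Im r = 0 ->
  complex.Im q = 0 -> complex.Im p = 0 ->
  complex.Re (2%:R^-1 * (2%:R^-1 * (p + - 'i * r) + 'i * (2%:R^-1 * (q + - 'i * t))))
  = 4%:R^-1 * (complex.Re p + complex.Re t).
Proof.
move=> t0 r0 q0 p0; rewrite -complexiE.
have -> : (2%:R^-1 : C) = (2%:R^-1 : R)%:C by rewrite fmorphV rmorph_nat.
rewrite !(cReM, cImM, cReD, cImD, cReN, cImN) t0 r0 q0 p0 /=.
by field.
Qed.

(** For real [f] the mixed second derivatives contribute only to the imaginary part, which leaves
    the two pure ones. *)
Lemma Re_delb_del U f z a : open U -> U z -> smooth U f ->
  (forall y, U y -> complex.Im (f y) = 0) ->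
  complex.Re (delb (conjv a) (del a f) z) =
  4%:R^-1 * (complex.Re (rderive a (rderive a f) z)
    + complex.Re (rderive ('i *: a) (rderive ('i *: a) f) z)).
Proof.
move=> oU Uz fs f0.
have as1 := smooth_rderive a fs; have as2 := smooth_rderive ('i *: a) fs.
pose k := fun y => 2%:R^-1 * (rderive a f y + - 'i * rderive ('i *: a) f y).
have ks : smooth U k.
  apply: smooth_mul => //; first exact: smooth_cst.
  by apply: smooth_add => //; apply: smooth_mul => //; exact: smooth_cst.
have dk : {near z, del a f =1 k}.
  apply: filterS (open_nbhs_nbhs (conj oU Uz)) => y Uy.
  by rewrite (delE _ oU Uy fs) /k mulNr.
have kd v : rderive v k z = 2%:R^-1 * (rderive v (rderive a f) z
     + - 'i * rderive v (rderive ('i *: a) f) z).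
  apply: is_rderive_rderive; apply: is_rderiveZ; apply: is_rderiveD.
    exact: smooth_is_rderive as1 Uz.
  by apply: is_rderiveZ; exact: smooth_is_rderive as2 Uz.
rewrite (delb_near _ dk) (delbE _ oU Uz ks) (kd a) (kd ('i *: a)).
have I1 v : complex.Im (rderive v (rderive a f) z) = 0.
  by apply: (Im_rderive _ oU Uz as1) => y Uy; exact: (Im_rderive a oU Uy fs f0).
have I2 v : complex.Im (rderive v (rderive ('i *: a) f) z) = 0.
  by apply: (Im_rderive _ oU Uz as2) => y Uy; exact: (Im_rderive ('i *: a) oU Uy fs f0).
have := I1 a; have := I1 ('i *: a); have := I2 a; have := I2 ('i *: a).
exact: wirtinger_real.
Qed.

End RealLaplacian.

(** * From local maxima to local constancy *)

Opaque sqn rderive.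

Section LocallyConstant.
Variables (R : realType) (n : nat) (X : topologicalType).
Variable A : complexAtlas R n X.
Local Notation C := R[i].
Local Notation Cn := 'rV[R[i]]_n.
Implicit Types (i : chart A) (x : X) (z : Cn).

Lemma near_interior (T : topologicalType) (P : set T) (x : T) :
  (\forall y \near x, P y) -> \forall y \near x, \forall y' \near y, P y'.
Proof. exact: nbhs_interior. Qed.

Lemma chart_img_inv i z : chart_img i z ->
  chart_dom i (chart_inv i z) /\ chart_map i (chart_inv i z) = z.
Proof. by move=> [x xi <-]; rewrite chart_mapK. Qed.

Variables (u : X -> R) (f : chart A -> Cn -> C).
Hypothesis fs : forall i, smooth (chart_img i) (f i).
Hypothesis uf : forall i x, chart_dom i x -> u x = complex.Re (f i (chart_map i x)).

Lemma chart_function_continuous x : {for x, continuous u}.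
Proof.
have [i xi] := chart_dom_cover A x.
have xz : chart_img i (chart_map i x) by exists x.
have c : {for x, continuous (fun y => complex.Re (f i (chart_map i y)))}.
  apply: (@continuous_comp _ _ _ (chart_map i) (fun z => complex.Re (f i z))).
    exact: chart_map_continuous.
  exact: (Re_smooth_continuous (fs i) xz).
apply: continuous_near c.
apply: filterS (open_nbhs_nbhs (conj (chart_dom_open i) xi)) => y yi.
by rewrite (uf yi).
Qed.

Lemma near_chart i z : chart_img i z ->
  (\forall y \near chart_inv i z, u y = u (chart_inv i z)) ->
  \forall y \near z, complex.Re (f i y) = complex.Re (f i z).
Proof.
move=> zi uz.
have inv_near : \forall y \near z, u (chart_inv i y) = u (chart_inv i z).
  exact: (chart_inv_continuous zi uz).
have im : \forall y \near z, chart_img i y.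
  by apply: open_nbhs_nbhs; split => //; exact: chart_img_open.
near=> y.
have yi : chart_img i y by near: y.
have [yd ye] := chart_img_inv yi; have [zd ze] := chart_img_inv zi.
have : u (chart_inv i y) = u (chart_inv i z) by near: y.
by rewrite (uf yd) (uf zd) ye ze.
Unshelve. all: by end_near. Qed.

Hypothesis compactX : compact [set: X].
Hypothesis fmax : forall i z, chart_img i z ->
  (\forall y \near z, complex.Re (f i y) <= complex.Re (f i z)) ->
  \forall y \near z, complex.Re (f i y) = complex.Re (f i z).

Lemma continuous_neq (F : R -> R) (t c : R) : {for t, continuous F} ->
  F t <> c -> \forall t' \near t, F t' <> c.
Proof.
move=> Ft; case: (ltgtP (F t) c) => // tc _.
- have H : \forall t' \near t, F t' < c by move/cvgr_lt : Ft; apply.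
  by near=> t' => e; have : F t' < c by [near: t'|]; rewrite e ltxx.
- have H : \forall t' \near t, c < F t' by move/cvgr_gt : Ft; apply.
  by near=> t' => e; have : c < F t' by [near: t'|]; rewrite e ltxx.
Unshelve. all: by end_near. Qed.

(** The points of the segment where [F] keeps its initial value form a nonempty set that is
    relatively open and closed. *)
Lemma connected_segment_constant (F : R -> R) :
  (forall t, `[0, 1]%classic t -> {for t, continuous F}) ->
  (forall t, `[0, 1]%classic t -> F t = F 0 -> \forall t' \near t, F t' = F 0) ->
  F 1 = F 0.
Proof.
move=> Fc Fl.
pose B := [set t | `[0, 1]%classic t /\ F t = F 0].
have BE : B = `[0, 1]%classic.
  apply: (@segment_connected R 0 1).
  - by exists 0; split => //=; rewrite in_itv /= lexx ler01.
  - exists (interior [set t | F t = F 0]); first exact: open_interior.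
    apply/seteqP; split => t [tI tF]; split => //; first exact: Fl.
    exact: (nbhs_singleton tF).
  - exists (~` interior [set t | F t <> F 0]); first exact/open_closedC/open_interior.
    apply/seteqP; split => t [tI tF]; split => //.
      by move=> H; exact: (nbhs_singleton H tF).
    apply: contrapT => tF'; apply: tF.
    exact: continuous_neq (Fc t tI) tF'.
have : `[0, 1]%classic (1 : R) by rewrite /= in_itv /= lexx ler01.
by rewrite -BE => -[].
Qed.

(* Let u reach at p its maximum over the closed set where u is not locally
   constant. If u exceeded u(p) at a point near p, then along the segment from
   that point to p it would stay constant, hence exceed u(p) at p too. So p is a
   local maximum of u on the whole of X. *)
Theorem locally_constant_of_strong_maximum x : \forall y \near x, u y = u x.
Proof.
pose L := [set x | \forall y \near x, u y = u x].
suff : ~` L = set0 by move=> L0; apply: contrapT => xL; have : (~` L) x by []; rewrite L0.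
have oL : open L.
  rewrite openE => y Ly; apply: filterS2 (near_interior Ly) Ly => y' near_y' yy'.
  by rewrite /L /=; apply: filterS near_y' => y'' ->.
have cK : compact (~` L).
  by apply: (subclosed_compact (open_closedC oL) compactX) => ?.
apply: contrapT => /eqP/set0P K0.
have [p Kp pmax] := compact_max K0 cK (fun y _ => chart_function_continuous (x := y)).
apply: Kp; have [i pi] := chart_dom_cover A p.
pose z := chart_map i p; have zi : chart_img i z by exists p.
have up : u p = complex.Re (f i z) by exact: uf.
have fz : \forall y \near z, complex.Re (f i y) <= complex.Re (f i z).
  have [r r0 rI] := nbhs_sqn (open_nbhs_nbhs (conj (@chart_img_open _ _ _ A i) zi)).
  have : \forall y \near z, sqn (y - z) < r.
    have : sqn (y - z) @[y --> z] --> sqn (z - z) by exact: sqn_continuous.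
    by move/cvgr_lt; apply; rewrite subrr sqn0.
  apply: filterS => y yr; rewrite leNgt; apply/negP => zy.
  pose F t := complex.Re (f i (y + t%:C *: (z - y))).
  (* Moving from [y] to [z] scales the distance to [z] by [1 - t], so the segment stays in a ball
     contained in the chart image. *)
  have tI t : `[0, 1]%classic t -> chart_img i (y + t%:C *: (z - y)).
    rewrite /= in_itv /= => /andP[t0 t1]; apply: rI; apply: le_lt_trans yr.
    have -> : y + t%:C *: (z - y) - z = 0 + (1 - t)%:C *: (y - z).
      have -> : (1 - t)%:C = 1 - t%:C :> C by rewrite rmorphB rmorph1.
      by rewrite add0r scalerBl scale1r -(opprB z y) scalerN opprK opprB addrAC.
    rewrite sqn_line sqn0 linear0l mulr0 mul0r !add0r ler_piMr ?sqn_ge0 //.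
    by rewrite expr_le1 ?subr_ge0 // lerBlDr lerDl.
  have F1 : F 1 = complex.Re (f i z) by rewrite /F scale1r addrC subrK.
  have F0 : F 0 = complex.Re (f i y) by rewrite /F line0.
  suff F10 : F 1 = F 0 by move: zy; rewrite -F0 -F1 F10 ltxx.
  apply: connected_segment_constant => [t tt|t tt Ft].
    apply: (@continuous_comp _ _ _ (fun t : R => y + t%:C *: (z - y))
      (fun y => complex.Re (f i y))).
      exact: line_continuous.
    exact: (Re_smooth_continuous (fs i) (tI t tt)).
  have qi := tI t tt; set q := y + _ in qi.
  have [qd qe] := chart_img_inv qi.
  have uq : u (chart_inv i q) = F t by rewrite (uf qd) qe.
  have Lq : L (chart_inv i q).
    apply: contrapT => Kq; have := pmax _ Kq.
    by rewrite uq Ft F0 up leNgt zy.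
  rewrite -Ft; exact: (@line_continuous R n y (z - y) t _ (near_chart qi Lq)).
have := fmax zi fz => fzn.
have pn : \forall y \near p, complex.Re (f i (chart_map i y)) = complex.Re (f i z).
  exact: (chart_map_continuous pi fzn).
apply: filterS2 pn (open_nbhs_nbhs (conj (chart_dom_open i) pi)) => y yz yi.
by rewrite (uf yi) up.
Qed.

End LocallyConstant.

(** * Contraction and wedge product *)

Section Contraction.
Variables (R : realType) (n : nat).
Local Notation C := R[i].
Local Notation Cn := 'rV[R[i]]_n.
Local Notation E := (ext R n).
Implicit Types (w y u : E) (Z : Cn) (S T A : {set 'I_n}) (a : 'I_n).

(** The contraction has degree [k - 1] and [u] has degrees at least [n + 2 - k], so the product
    would have degree at least [n + 1]. *)
Lemma wedge_contract_degree (k : nat) w u Z :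
  (forall S, #|S| != k -> w S = 0) ->
  (forall S, ~~ (n + 2 <= #|S| + k)%N -> u S = 0) ->
  ext_wedge (ext_contract Z w) u = 0.
Proof.
move=> wk un; apply/ffunP => S; rewrite !ffunE big1 // => A AS.
have [Ak|/un ->] := boolP (n + 2 <= #|S :\: A| + k)%N; last by rewrite mulr0.
rewrite ffunE big1 ?mulr0 ?mul0r // => a aA.
rewrite wk ?mulr0 // cardsU1 aA; apply/negP => /eqP kE.
have := max_card (mem S); rewrite card_ord => Sn.
have := cardsD S A; have /finset.setIidPr -> := AS => SA.
have AS' : (#|A| <= #|S|)%N by exact: subset_leq_card.
move: Ak; rewrite -kE SA; move: Sn AS'; move: #|S| #|A| => p q /=; lia.
Qed.

(** Only the splitting of [S] into [S :\ a] and [a] contributes. The contraction sign counts the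
    elements of [S] below [a], the wedge sign those above, together [#|S|.-1]. *)
Lemma wedge_contract_dz a w S :
  ext_wedge (ext_contract (delta_mx 0 a) w) (dz R a) S =
  if a \in S then (-1) ^+ #|S|.-1 * w S else 0.
Proof.
rewrite ffunE; case: ifP => aS; last first.
  apply: big1 => A AS; rewrite [dz R a _]ffunE.
  case: (S :\: A =P finset.set1 a) => [SA|_]; last by rewrite /= mulr0.
  have : a \in S :\: A by rewrite SA finset.set11.
  by rewrite inE aS andbF.
rewrite (bigD1 (S :\ a)) ?finset.subsetDl //= big1 ?addr0; last first.
  move=> A /andP[AS AN]; rewrite [dz R a _]ffunE.
  case: (S :\: A =P finset.set1 a) => [SA|_]; last by rewrite /= mulr0.
  move: AN; rewrite -SA finset.setDDr finset.setDv finset.set0U.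
  have /finset.setIidPr -> := AS.
  by rewrite eqxx.
have SSa : S :\: (S :\ a) = finset.set1 a.
  by rewrite finset.setDDr finset.setDv finset.set0U;
    apply/finset.setIidPr; rewrite finset.sub1set.
rewrite SSa [dz R a _]ffunE eqxx mulr1 ffunE.
rewrite (bigD1 a) ?finset.setD11 //= big1 ?addr0; last first.
  by move=> b /andP[_ /negbTE ba]; rewrite mxE eqxx ba mulr0 mul0r.
rewrite mxE !eqxx mulr1 finset.setD1K // mulrA -exprD; congr (_ ^+ _ * _).
have -> : inversions (S :\ a) (finset.set1 a) = #|[pred b in S :\ a | (a < b)%N]|.
  rewrite /inversions -[RHS](card_imset _ (f := fun b => (b, a))); last by move=> b c [].
  apply: eq_card => -[b c]; rewrite !inE /=; apply/idP/imsetP.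
    by move=> /and3P[bS /eqP -> ab]; exists b => //; rewrite !inE bS.
  by move=> [d]; rewrite !inE => /andP[dS ad] [-> ->]; rewrite dS eqxx.
have -> : #|S|.-1 = #|S :\ a| by rewrite (cardsD1 a S) aS.
rewrite -(cardID [pred b : 'I_n | (a < b)%N] (mem (S :\ a))); congr (_ + _)%N.
apply: eq_card => b; rewrite !inE -leqNgt -(inj_eq val_inj) /=.
by case: ltngtP; rewrite /= ?andbT ?andbF.
Qed.

(** With [dz a] on the right, Euler's identity carries the sign [(-1) ^+ k.-1], which is 1 for odd
    [k]; each [S] of size [k] is counted once per element. *)
Lemma euler_contract (k : nat) w : odd k -> (forall S, #|S| != k -> w S = 0) ->
  \sum_a ext_wedge (ext_contract (delta_mx 0 a) w) (dz R a) = k%:R *: w.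
Proof.
move=> ko wk; apply/ffunP => S; rewrite sum_ffunE [RHS]ffunE.
rewrite (eq_bigr _ (fun a _ => wedge_contract_dz a w S)) -big_mkcond sumr_const.
have [->|/wk ->] := eqVneq #|S| k; last by rewrite mulr0 mul0rn scaler0.
have -> : (-1) ^+ k.-1 = 1 :> C.
  by rewrite -signr_odd; case: k ko {wk} => //= k /negbTE ->.
by rewrite mul1r -[LHS]mulr_natl.
Qed.

End Contraction.

(** * Vanishing in a chart and the theorem *)

Opaque sqn rderive ddz ddzb.

Section ChartVanishing.
Variables (R : realType) (n : nat).
Local Notation C := R[i].
Local Notation Cn := 'rV[R[i]]_n.
Local Notation E := (ext R n).
Variables (h : Cn -> {dot E for Num.conj}) (U : set Cn) (w s : Cn -> E).
Hypotheses (oU : open U) (hs : forall u v, smooth U (fun z => h z u v)).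
Hypothesis wh : forall S, holomorphic U (fun z => w z S).
Hypothesis sh : forall S, holomorphic U (fun z => s z S).
Hypothesis sk : forall z Z, U z -> higgs w z Z (s z) = 0.
Variable g : Cn -> {dot Cn for Num.conj}.
Hypothesis gs : forall u v, smooth U (fun z => g z u v).
Hypothesis Fle : forall z Z, U z -> orthonormal_basis (g z) Z ->
  h z (iLambdaF h (higgs w) Z s z) (s z) <= 0.
Implicit Types (z : Cn) (Z : 'M[C]_n).

Definition sqnorm z : C := h z (s z) (s z).

Lemma smooth_sqnorm : smooth U sqnorm.
Proof. by apply: smooth_pairing => //; exact: holomorphic_smooth_comps. Qed.

Lemma Im_sqnorm z : complex.Im (sqnorm z) = 0.
Proof. exact/ger0_Im/dnorm_ge0. Qed.

Lemma sqnorm_laplacian z Z : U z ->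
  \sum_a delb (conjv (row a Z)) (del (row a Z) sqnorm) z =
  \sum_a h z (del_h h (row a Z) s z) (del_h h (row a Z) s z)
  + \sum_a h z (adjoint (h z) (higgs w z (row a Z)) (s z))
               (adjoint (h z) (higgs w z (row a Z)) (s z))
  - h z (iLambdaF h (higgs w) Z s z) (s z).
Proof.
move=> Uz; rewrite iLambdaFE -sumrN -!big_split; apply: eq_bigr => a _.
by rewrite (bochner oU hs wh sh sk).
Qed.

Lemma sqnorm_strong_maximum p : U p ->
  (\forall z \near p, complex.Re (sqnorm z) <= complex.Re (sqnorm p)) ->
  \forall z \near p, complex.Re (sqnorm z) = complex.Re (sqnorm p).
Proof.
move=> Up pmax.
(* [strong_maximum] wants a maximum over its whole open set, so the local maximum is made global by
   shrinking [U]. *)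
pose V := U `&` interior [set z | complex.Re (sqnorm z) <= complex.Re (sqnorm p)].
have oV : open V by apply: openI => //; exact: open_interior.
have VU : V `<=` U by move=> ? [].
apply: (@strong_maximum _ _ V p sqnorm g) => //.
- exact: smooth_sub VU smooth_sqnorm.
- by move=> u v; exact: smooth_sub VU (gs u v).
- move=> z Z /VU Uz oZ.
  have : 0 <= complex.Re (\sum_a delb (conjv (row a Z)) (del (row a Z) sqnorm) z).
    rewrite sqnorm_laplacian //.
    have := Fle Uz oZ; move: (h z (iLambdaF _ _ _ _ _) _) => y y0.
    have : 0 <= \sum_a h z (del_h h (row a Z) s z) (del_h h (row a Z) s z)
      + \sum_a h z (adjoint (h z) (higgs w z (row a Z)) (s z))
               (adjoint (h z) (higgs w z (row a Z)) (s z)) - y.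
      rewrite addr_ge0 ?oppr_ge0 // addr_ge0 // sumr_ge0 // => a _; exact: dnorm_ge0.
    by rewrite lecE => /andP[].
  rewrite (big_morph _ (@cReD R) (erefl : complex.Re 0 = 0)).
  rewrite (eq_bigr _ (fun a _ => Re_delb_del (row a Z) oU Uz smooth_sqnorm
    (fun y _ => Im_sqnorm y))).
  by rewrite -mulr_sumr pmulr_rge0 // invr_gt0 ltr0n.
- by move=> z [_ /nbhs_singleton].
Qed.

Hypothesis sqnorm_const : forall z, U z ->
  \forall y \near z, complex.Re (sqnorm y) = complex.Re (sqnorm z).

Lemma laplacian_terms_eq0 z Z : U z -> orthonormal_basis (g z) Z ->
  forall a, del_h h (row a Z) s z = 0 /\
            adjoint (h z) (higgs w z (row a Z)) (s z) = 0.
Proof.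
move=> Uz oZ.
(* Two nested neighbourhoods, because the first derivative must vanish near [z] for the second to
   vanish at [z]. *)
have nc : \forall y \near z, \forall y' \near y, sqnorm y' = sqnorm z.
  apply: near_interior; apply: filterS (sqnorm_const Uz) => y yz.
  by apply: complex_eqP; rewrite ?Im_sqnorm.
have L0 : \sum_a delb (conjv (row a Z)) (del (row a Z) sqnorm) z = 0.
  apply: big1 => a _.
  have d0 : {near z, del (row a Z) sqnorm =1 (fun=> 0)}.
    apply: filterS nc => y yc.
    have -> : del (row a Z) sqnorm y = del (row a Z) (fun=> sqnorm z) y by exact: del_near.
    rewrite (delE (U := setT)) //; [|exact: openT|by apply: smooth_cst; exact: openT].
    by rewrite !(is_rderive_rderive (is_rderive_cst _ _ _)) mulr0 subrr mulr0.
  by rewrite (delb_near _ d0) delb_cst.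
move: L0; rewrite sqnorm_laplacian // => /eqP.
have sigma_ge0 : 0 <= \sum_a h z (del_h h (row a Z) s z) (del_h h (row a Z) s z).
  by apply: sumr_ge0 => a _; exact: dnorm_ge0.
have tau_ge0 : 0 <= \sum_a h z (adjoint (h z) (higgs w z (row a Z)) (s z))
               (adjoint (h z) (higgs w z (row a Z)) (s z)).
  by apply: sumr_ge0 => a _; exact: dnorm_ge0.
rewrite paddr_eq0 ?addr_ge0 ?oppr_ge0 ?Fle // => /andP[+ _].
rewrite paddr_eq0 // => /andP[/eqP s0 /eqP t0] a.
split; apply/eqP; rewrite -(dnorm_eq0 (h z)); apply/eqP.
  by apply: (psumr_eq0P _ s0) => // b _; exact: dnorm_ge0.
by apply: (psumr_eq0P _ t0) => // b _; exact: dnorm_ge0.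
Qed.

(** The conjugation in [conjv] cancels that of the second argument of [h], whence linearity over the
    complex numbers in the direction. It carries vanishing from an orthonormal basis to every
    direction. *)
Lemma chern_spec_comb (c : C) a b z u v : chern_spec h a s z u -> chern_spec h b s z v ->
  chern_spec h (c *: a + b) s z (c *: u + v).
Proof.
move=> us vs V t oV Vz ts.
have -> : del (c *: a + b) (fun y => h y (s y) (t y)) z =
   c * del a (fun y => h y (s y) (t y)) z + del b (fun y => h y (s y) (t y)) z.
  rewrite /del mulr_sumr -big_split; apply: eq_bigr => j _ /=.
  by rewrite !mxE mulrDl mulrA.
have -> : dbar (conjv (c *: a + b)) t z =
    Num.conj c *: dbar (conjv a) t z + dbar (conjv b) t z.
  apply/ffunP => S; rewrite !ffunE [X in _ = X + _]mulr_sumr -big_split.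
  apply: eq_bigr => j _ /=; rewrite !conjvE !mxE rmorphD rmorphM /= mulrDl; congr (_ + _).
  by rewrite -mulrA.
rewrite (us V t oV Vz ts) (vs V t oV Vz ts) dotDl dotDr dotZl dotZr conjCK.
by rewrite mulrDr addrACA.
Qed.

Lemma del_h_eq0 z a : U z -> del_h h a s z = 0.
Proof.
move=> Uz; have [Z oZ] := orthonormal_basis_exists (g z).
have ss := holomorphic_smooth_comps sh.
have aE := orthonormal_basis_expand a oZ.
apply: del_h_spec; rewrite aE.
have z0 : chern_spec h 0 s z 0.
  rewrite -[X in chern_spec _ _ _ _ X](del_h0 h s z).
  exact: (del_hP oU hs 0 Uz ss).
elim/big_rec : _ => // j v _ v0.
have -> : (0 : E) = g z a (row j Z) *: 0 + 0 by rewrite scaler0 addr0.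
apply: chern_spec_comb => //.
by rewrite -(laplacian_terms_eq0 Uz oZ j).1; exact: (del_hP oU hs _ Uz ss).
Qed.

Lemma higgs_adjoint_eq0 z a : U z -> adjoint (h z) (higgs w z a) (s z) = 0.
Proof.
move=> Uz; have [Z oZ] := orthonormal_basis_exists (g z).
apply: (@dot_inj _ _ (h z)) => v; rewrite (higgs_adjointP h w) linear0l.
rewrite (orthonormal_basis_expand a oZ) /higgs.
elim/big_rec : _ => [|j b _ b0]; first by rewrite ext_contract0l ext_wedge0l linear0r.
rewrite ext_contractDl ext_wedgeDl dotDr dotZr b0 addr0.
rewrite -[h z (s z) _](higgs_adjointP h w z (row j Z)).
by rewrite (laplacian_terms_eq0 Uz oZ j).2 linear0l mulr0.
Qed.

Lemma nabla_eq0 z v : U z -> nabla h v s z = 0.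
Proof. by move=> Uz; rewrite /nabla del_h_eq0 // (holomorphic_dbar sh) // addr0. Qed.

(** By [F_hE] each curvature term is [theta(Z) tau_Z - dbar sigma_Z]; tau vanishes at [z], and sigma
    vanishes near [z], hence so does its [dbar] there. *)
Lemma iLambdaF_eq0 z Z : U z -> iLambdaF h (higgs w) Z s z = 0.
Proof.
move=> Uz; rewrite /iLambdaF big1 // => a _.
rewrite (F_hE oU hs wh sh sk) // higgs_adjoint_eq0 // [higgs _ _ _ 0]linear0 sub0r.
have n0 : {near z, del_h h (row a Z) s =1 (fun=> 0)}.
  by apply: filterS (open_nbhs_nbhs (conj oU Uz)) => y; exact: del_h_eq0.
rewrite (dbar_near _ n0); apply/eqP; rewrite oppr_eq0; apply/eqP/ffunP => S.
by rewrite dbarE ffunE delb_cst.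
Qed.

End ChartVanishing.

Theorem theorem1 (R : realType) (n : nat) (X : topologicalType)
  (hausdorffX : hausdorff_space X) (compactX : compact [set: X])
  (A : complexAtlas R n X)
  (g : chart A -> 'rV[R[i]]_n -> {dot 'rV[R[i]]_n for Num.conj})
  (gP : hermitian_metric_T g)
  (k : nat) (k_ge3 : (3 <= k)%N) (k_odd : odd k)
  (varpi : chart A -> 'rV[R[i]]_n -> ext R n)
  (varpiP : holomorphic_form k varpi)
  (h : chart A -> 'rV[R[i]]_n -> {dot (ext R n) for Num.conj})
  (hP : hermitian_metric_E h)
  (F_le0 : forall t : chart A -> 'rV[R[i]]_n -> ext R n, smooth_section t ->
     forall i z Z, chart_img i z -> orthonormal_basis (g i z) Z ->
       h i z (iLambdaF (h i) (higgs (varpi i)) Z (t i) z) (t i z) <= 0) :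
  (forall s : chart A -> 'rV[R[i]]_n -> ext R n,
     holomorphic_section s ->
     in_degrees (fun a => (n + 2 <= a + k)%N) s ->
     [/\ forall i z v, chart_img i z -> nabla (h i) v (s i) z = 0,
         forall i z Z, chart_img i z ->
           adjoint (h i z) (ext_wedge (ext_contract Z (varpi i z))) (s i z) = 0
       & forall i z Z, chart_img i z -> orthonormal_basis (g i z) Z ->
           iLambdaF (h i) (higgs (varpi i)) Z (s i) z = 0]) /\
  ((n + 2 <= 2 * k)%N ->
     forall i z, chart_img i z -> varpi i z = 0).
Proof.
have imgO (i : chart A) : open (chart_img i) by exact: chart_img_open.
have [[varpi_sec varpi_hol] varpi_deg] := varpiP.
have main s : holomorphic_section s -> in_degrees (fun a => (n + 2 <= a + k)%N) s ->
    [/\ forall i z v, chart_img i z -> nabla (h i) v (s i) z = 0,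
         forall i z Z, chart_img i z ->
           adjoint (h i z) (ext_wedge (ext_contract Z (varpi i z))) (s i z) = 0
       & forall i z Z, chart_img i z -> orthonormal_basis (g i z) Z ->
           iLambdaF (h i) (higgs (varpi i)) Z (s i) z = 0].
  move=> [s_sec s_hol] s_deg.
  have sk i z Z : chart_img i z -> higgs (varpi i) z Z (s i z) = 0.
    move=> zi; apply: (@wedge_contract_degree _ _ k) => S; first exact: varpi_deg zi.
    exact: s_deg zi.
  have Fle i z Z : chart_img i z -> orthonormal_basis (g i z) Z ->
      h i z (iLambdaF (h i) (higgs (varpi i)) Z (s i) z) (s i z) <= 0.
    by apply: F_le0; split => // j S; exact: (s_hol j S).1.
  (* The squared norm as a function on [X], read in an arbitrarily chosen chart; [uE] removes the
     choice, [h] being invariant under changes of chart. *)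
  pose u x := let i := projT1 (cid (chart_dom_cover A x)) in
    complex.Re (sqnorm (h i) (s i) (chart_map i x)).
  have uE i x : chart_dom i x -> u x = complex.Re (sqnorm (h i) (s i) (chart_map i x)).
    move=> xi; rewrite /u; case: (cid _) => j xj /=.
    by rewrite /sqnorm (s_sec i j x xi xj) (hP.2 i j x _ _ xi xj).
  have fsm i : smooth (chart_img i) (sqnorm (h i) (s i)).
    by apply: smooth_sqnorm => //; exact: hP.1.
  have smax i z : chart_img i z ->
      (\forall y \near z,
         complex.Re (sqnorm (h i) (s i) y) <= complex.Re (sqnorm (h i) (s i) z)) ->
      \forall y \near z,
         complex.Re (sqnorm (h i) (s i) y) = complex.Re (sqnorm (h i) (s i) z).
    move=> zi zm.
    exact: (sqnorm_strong_maximum (imgO i) (hP.1 i) (varpi_hol i) (s_hol i) (sk i)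
      (gP.1 i) (Fle i) zi zm).
  have uconst := locally_constant_of_strong_maximum fsm uE compactX smax.
  have fconst i z : chart_img i z ->
      \forall y \near z,
         complex.Re (sqnorm (h i) (s i) y) = complex.Re (sqnorm (h i) (s i) z).
    move=> zi; exact: (@near_chart _ _ _ A u
      (fun i => sqnorm (h i) (s i)) uE i z zi (uconst _)).
  split=> i z.
  - move=> v zi.
    exact: (nabla_eq0 (imgO i) (hP.1 i) (varpi_hol i) (s_hol i) (sk i)
      (Fle i) (fconst i)).
  - move=> Z zi.
    exact: (higgs_adjoint_eq0 (imgO i) (hP.1 i) (varpi_hol i) (s_hol i) (sk i)
      (Fle i) (fconst i)).
  - move=> Z zi _.
    exact: (iLambdaF_eq0 (imgO i) (hP.1 i) (varpi_hol i) (s_hol i) (sk i)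
      (Fle i) (fconst i)).
split=> // n2k i z zi.
(* The bound on [k] says precisely that [k] is one of the degrees allowed in the first part. *)
have vdeg : in_degrees (fun a => (n + 2 <= a + k)%N) varpi.
  move=> j y S yj Sk; apply: varpi_deg yj _; apply: contra Sk => /= /eqP ->.
  by rewrite addnn -mul2n.
have [_ adj0 _] := main varpi varpiP.1 vdeg.
have hv (Z : 'rV[R[i]]_n) y :
    h i z (varpi i z) (ext_wedge (ext_contract Z (varpi i z)) y) = 0.
  have := adjointP (h i z) (ext_wedge (ext_contract Z (varpi i z))) (varpi i z) y.
  by move=> /= <-; rewrite adj0 // linear0l.
(* Pairing Euler's identity with [varpi] leaves [0 = k h(varpi, varpi)], and [k] is nonzero. *)
have := euler_contract k_odd (fun S Sk => varpi_deg i z S zi Sk).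
move=> /(congr1 (h i z (varpi i z))); rewrite dot_sumr big1 => [|a _]; last exact: hv.
move/esym/eqP; rewrite dotZr mulf_eq0 conjC_eq0 pnatr_eq0 dnorm_eq0.
by case: k k_ge3 {varpiP varpi_deg k_odd n2k main vdeg F_le0} => //= k' _ /eqP.
Qed.
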